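(* Let $J_D:=I_D/(G)\subset R_G$. The affine coordinate ring $R_{\Pi}$ of $\Pi_{\mathbb{A}}^{15}$ is isomorphic to the unprojection ring $R_G[J_D^{-1}]$, where $J_D^{-1}:=\{f\in Q_G\mid fJ_D\subset R_G\}$ and $R_G[J_D^{-1}]$ is the subring of $Q_G$ generated by $J_D^{-1}$ over $R_G$. In particular, $R_{\Pi}$ is a domain.
   Context: We work over $\mathbb{C}$. Let $S_G=\mathbb{C}[p_1,p_2,p_3,p_4,u,v,t_1,t_2,L_{123},L_{124},L_{125},L_{126},L_{135},L_{136},L_{245},L_{246}]$ and $\tilde{S}_G=\mathbb{C}[p_1,p_2,p_3,p_4,t_1,w,L_{123},L_{124},L_{125},L_{126},L_{135},L_{136},L_{245},L_{246}]$. Let $h\colon S_G\to\tilde{S}_G$ be the ring homomorphism with $u\mapsto wp_1+w^2p_2$, $v\mapsto wp_3+w^2p_4$, $t_2\mapsto w^3+t_1w$ and the other variables unchanged; $I_D:=\ker h$. Let \[ \mathsf{M}=\begin{pmatrix}u&v&-t_2p_2&-t_2p_4&-t_2p_1+t_1u&-t_2p_3+t_1v\\-p_1&-p_3&u+t_1p_2&v+t_1p_4&-t_2p_2&-t_2p_4\\-p_2&-p_4&-p_1&-p_3&u&v\end{pmatrix}, \] $D_{ijk}$ the minor of columns $i<j<k$ of $\mathsf{M}$, $D_{136}'=D_{136}+2D_{145}$, $D_{245}'=D_{245}+2D_{146}$, and \[ G=L_{123}D_{123}+L_{124}D_{124}+L_{125}D_{125}+L_{126}D_{126}+L_{135}D_{135}+L_{136}D_{136}'+L_{245}D_{245}'+L_{246}D_{246}\in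 I_D . \] $G$ is irreducible; $R_G:=S_G/(G)$ and $Q_G$ is its quotient field. Let $S_{\Pi}=S_G[s_1,s_2,s_3]$. Abbreviate $\Delta=p_1p_4-p_2p_3$, $\lambda(X,Y,Z)=L_{136}X+L_{245}Y+L_{246}Z$, $\mu(X,Y,Z)=L_{135}X+L_{136}Y+L_{245}Z$, $U_1=p_1^2+t_1p_2^2+p_2u$, $U_2=2p_1p_3+2t_1p_2p_4+p_4u+p_2v$, $U_3=p_3^2+t_1p_4^2+p_4v$, $I_1=t_2p_2^2+p_1u$, $I_2=2t_2p_2p_4+p_3u+p_1v$, $I_3=t_2p_4^2+p_3v$, $W_1=t_1p_2u-t_2p_1p_2+u^2$, $W_2=t_1(p_4u+p_2v)-t_2(p_2p_3+p_1p_4)+2uv$, $W_3=t_1p_4v-t_2p_3p_4+v^2$, $\kappa_1=L_{135}L_{245}-L_{136}^2$, $\kappa_2=L_{135}L_{246}-L_{136}L_{245}$, $\kappa_3=L_{136}L_{246}-L_{245}^2$. Let $I_{\Pi}\subset S_{\Pi}$ be the ideal generated by \begin{align*} F_1&=us_1-p_1s_2-p_2s_3-L_{126}\Delta-\lambda(U_1,U_2,U_3),\\ F_2&=vs_1-p_3s_2-p_4s_3+L_{125}\Delta+\mu(U_1,U_2,U_3),\\ F_3&=-t_2p_2s_1+(u+t_1p_2)s_2-p_1s_3-L_{124}\Delta-\lambda(I_1,I_2,I_3),\\ F_4&=-t_2p_4s_1+(v+t_1p_4)s_2-p_3s_3+L_{123}\Delta+\mu(I_1,I_2,I_3),\\ F_5&=-t_2p_1s_1+(t_1p_1-t_2p_2)s_2+(u+t_1p_2)s_3+L_{123}U_1+L_{124}(p_1p_3+t_1p_2p_4+p_2v)\\&\quad-L_{125}I_1-L_{126}(t_2p_2p_4+p_1v)-\lambda(W_1,W_2,W_3),\\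 F_6&=-t_2p_3s_1+(t_1p_3-t_2p_4)s_2+(v+t_1p_4)s_3+L_{123}(p_1p_3+t_1p_2p_4+p_4u)+L_{124}U_3\\&\quad-L_{125}(t_2p_2p_4+p_3u)-L_{126}I_3+\mu(W_1,W_2,W_3),\\ F_7&=-s_2^2+s_1s_3+(L_{123}p_2+L_{124}p_4)s_1-(L_{125}p_2+L_{126}p_4)s_2\\&\quad+L_{123}\lambda(p_2^2,2p_2p_4,p_4^2)-L_{124}\mu(p_2^2,2p_2p_4,p_4^2)\\&\quad-L_{125}\lambda(p_1p_2,p_2p_3+p_1p_4,p_3p_4)+L_{126}\mu(p_1p_2,p_2p_3+p_1p_4,p_3p_4)\\&\quad+\kappa_1(-p_1^2+2up_2+t_1p_2^2)+\kappa_2(-p_1p_3+up_4+vp_2+t_1p_2p_4)+\kappa_3(-p_3^2+2vp_4+t_1p_4^2),\\ F_8&=s_2s_3+t_1s_1s_2-t_2s_1^2+s_1(L_{123}p_1+L_{124}p_3)-s_2(L_{125}p_1+L_{126}p_3)\\&\quad+L_{123}\lambda(p_1p_2,p_1p_4+p_2p_3,p_3p_4)-L_{124}\mu(p_1p_2,p_1p_4+p_2p_3,p_3p_4)\\&\quad-L_{125}\lambda(p_1^2,2p_1p_3,p_3^2)+L_{126}\mu(p_1^2,2p_1p_3,p_3^2)\\&\quad+\kappa_1(2up_1+2t_1p_1p_2-t_2p_2^2)+\kappa_2(vp_1+up_3+t_1(p_1p_4+p_2p_3)-t_2p_2p_4)+\kappa_3(2vp_3+2t_1p_3p_4-t_2p_4^2),\\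 F_9&=t_1s_2^2+s_3^2-t_2s_1s_2+s_1(L_{123}u+L_{124}v)-s_2(L_{125}u+L_{126}v)+(L_{124}L_{125}-L_{123}L_{126})\Delta\\&\quad-L_{123}\lambda(p_1^2+t_1p_2^2,\,2p_1p_3+2t_1p_2p_4,\,p_3^2+t_1p_4^2)+L_{124}\mu(p_1^2+t_1p_2^2,\,2p_1p_3+2t_1p_2p_4,\,p_3^2+t_1p_4^2)\\&\quad+t_2L_{125}\lambda(p_2^2,2p_2p_4,p_4^2)-t_2L_{126}\mu(p_2^2,2p_2p_4,p_4^2)\\&\quad+\kappa_1(u^2+2t_2p_1p_2)+\kappa_2(uv+t_2(p_2p_3+p_1p_4))+\kappa_3(v^2+2t_2p_3p_4). \end{align*} $\Pi_{\mathbb{A}}^{15}\subset\mathbb{A}^{19}={\rm Spec}\,S_{\Pi}$ is the scheme defined by $I_{\Pi}$ and $R_{\Pi}:=S_{\Pi}/I_{\Pi}$. *)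

(* Defs.v *)
From HB Require Import structures.
From mathcomp Require Import all_boot all_order all_algebra.
From mathcomp Require Import generic_quotient ring_quotient fraction complex.
From mathcomp Require Import boolp classical_sets reals.
From mathcomp Require Import mpoly zify ring.

Set Implicit Arguments.
Unset Strict Implicit.
Unset Printing Implicit Defensive.

Import GRing.Theory.
Local Open Scope ring_scope.

(* The polynomials below are functions of the values x of the 16 variables    *)
(* p1, p2, p3, p4, u, v, t1, t2, L123, L124, L125, L126, L135, L136, L245,    *)
(* L246 of S_G (in this order), and of the values s of the 3 extra variables  *)
(* of S_Pi, in an arbitrary commutative ring.                                 *)
Section Formulas.
Variables (A : comNzRingType) (x : 'I_16 -> A).

Local Notation p1 := (x (@Ordinal 16 0 isT)).
Local Notation p2 := (x (@Ordinal 16 1 isT)).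
Local Notation p3 := (x (@Ordinal 16 2 isT)).
Local Notation p4 := (x (@Ordinal 16 3 isT)).
Local Notation u := (x (@Ordinal 16 4 isT)).
Local Notation v := (x (@Ordinal 16 5 isT)).
Local Notation t1 := (x (@Ordinal 16 6 isT)).
Local Notation t2 := (x (@Ordinal 16 7 isT)).
Local Notation L123 := (x (@Ordinal 16 8 isT)).
Local Notation L124 := (x (@Ordinal 16 9 isT)).
Local Notation L125 := (x (@Ordinal 16 10 isT)).
Local Notation L126 := (x (@Ordinal 16 11 isT)).
Local Notation L135 := (x (@Ordinal 16 12 isT)).
Local Notation L136 := (x (@Ordinal 16 13 isT)).
Local Notation L245 := (x (@Ordinal 16 14 isT)).
Local Notation L246 := (x (@Ordinal 16 15 isT)).

Definition Mmat : 'M[A]_(3, 6) := \matrix_(i, j) nth 0 (nth [::]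
  [:: [:: u; v; - t2 * p2; - t2 * p4; - t2 * p1 + t1 * u; - t2 * p3 + t1 * v];
      [:: - p1; - p3; u + t1 * p2; v + t1 * p4; - t2 * p2; - t2 * p4];
      [:: - p2; - p4; - p1; - p3; u; v]] i) j.

(* Columns are numbered from 1. *)
Definition Dminor (i j k : nat) : A :=
  \det (colsub (fun l : 'I_3 => inord (nth 0 [:: i; j; k] l).-1) Mmat).

Definition Gform : A :=
  L123 * Dminor 1 2 3 + L124 * Dminor 1 2 4 + L125 * Dminor 1 2 5
  + L126 * Dminor 1 2 6 + L135 * Dminor 1 3 5
  + L136 * (Dminor 1 3 6 + 2 * Dminor 1 4 5)
  + L245 * (Dminor 2 4 5 + 2 * Dminor 1 4 6) + L246 * Dminor 2 4 6.

Definition Delta := p1 * p4 - p2 * p3.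
Definition lam X Y Z := L136 * X + L245 * Y + L246 * Z.
Definition mu X Y Z := L135 * X + L136 * Y + L245 * Z.
Definition U1 := p1 ^+ 2 + t1 * p2 ^+ 2 + p2 * u.
Definition U2 := 2 * p1 * p3 + 2 * t1 * p2 * p4 + p4 * u + p2 * v.
Definition U3 := p3 ^+ 2 + t1 * p4 ^+ 2 + p4 * v.
Definition I1 := t2 * p2 ^+ 2 + p1 * u.
Definition I2 := 2 * t2 * p2 * p4 + p3 * u + p1 * v.
Definition I3 := t2 * p4 ^+ 2 + p3 * v.
Definition W1 := t1 * p2 * u - t2 * p1 * p2 + u ^+ 2.
Definition W2 :=
  t1 * (p4 * u + p2 * v) - t2 * (p2 * p3 + p1 * p4) + 2 * u * v.
Definition W3 := t1 * p4 * v - t2 * p3 * p4 + v ^+ 2.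
Definition kappa1 := L135 * L245 - L136 ^+ 2.
Definition kappa2 := L135 * L246 - L136 * L245.
Definition kappa3 := L136 * L246 - L245 ^+ 2.

Variable s : 'I_3 -> A.

Local Notation s1 := (s (@Ordinal 3 0 isT)).
Local Notation s2 := (s (@Ordinal 3 1 isT)).
Local Notation s3 := (s (@Ordinal 3 2 isT)).

Definition F1 :=
  u * s1 - p1 * s2 - p2 * s3 - L126 * Delta - lam U1 U2 U3.

Definition F2 :=
  v * s1 - p3 * s2 - p4 * s3 + L125 * Delta + mu U1 U2 U3.

Definition F3 :=
  - t2 * p2 * s1 + (u + t1 * p2) * s2 - p1 * s3 - L124 * Delta - lam I1 I2 I3.

Definition F4 :=
  - t2 * p4 * s1 + (v + t1 * p4) * s2 - p3 * s3 + L123 * Delta + mu I1 I2 I3.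

Definition F5 :=
  - t2 * p1 * s1 + (t1 * p1 - t2 * p2) * s2 + (u + t1 * p2) * s3
  + L123 * U1 + L124 * (p1 * p3 + t1 * p2 * p4 + p2 * v)
  - L125 * I1 - L126 * (t2 * p2 * p4 + p1 * v) - lam W1 W2 W3.

Definition F6 :=
  - t2 * p3 * s1 + (t1 * p3 - t2 * p4) * s2 + (v + t1 * p4) * s3
  + L123 * (p1 * p3 + t1 * p2 * p4 + p4 * u) + L124 * U3
  - L125 * (t2 * p2 * p4 + p3 * u) - L126 * I3 + mu W1 W2 W3.

Definition F7 :=
  - s2 ^+ 2 + s1 * s3 + (L123 * p2 + L124 * p4) * s1
  - (L125 * p2 + L126 * p4) * s2
  + L123 * lam (p2 ^+ 2) (2 * p2 * p4) (p4 ^+ 2)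
  - L124 * mu (p2 ^+ 2) (2 * p2 * p4) (p4 ^+ 2)
  - L125 * lam (p1 * p2) (p2 * p3 + p1 * p4) (p3 * p4)
  + L126 * mu (p1 * p2) (p2 * p3 + p1 * p4) (p3 * p4)
  + kappa1 * (- p1 ^+ 2 + 2 * u * p2 + t1 * p2 ^+ 2)
  + kappa2 * (- p1 * p3 + u * p4 + v * p2 + t1 * p2 * p4)
  + kappa3 * (- p3 ^+ 2 + 2 * v * p4 + t1 * p4 ^+ 2).

Definition F8 :=
  s2 * s3 + t1 * s1 * s2 - t2 * s1 ^+ 2
  + s1 * (L123 * p1 + L124 * p3) - s2 * (L125 * p1 + L126 * p3)
  + L123 * lam (p1 * p2) (p1 * p4 + p2 * p3) (p3 * p4)
  - L124 * mu (p1 * p2) (p1 * p4 + p2 * p3) (p3 * p4)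
  - L125 * lam (p1 ^+ 2) (2 * p1 * p3) (p3 ^+ 2)
  + L126 * mu (p1 ^+ 2) (2 * p1 * p3) (p3 ^+ 2)
  + kappa1 * (2 * u * p1 + 2 * t1 * p1 * p2 - t2 * p2 ^+ 2)
  + kappa2 * (v * p1 + u * p3 + t1 * (p1 * p4 + p2 * p3) - t2 * p2 * p4)
  + kappa3 * (2 * v * p3 + 2 * t1 * p3 * p4 - t2 * p4 ^+ 2).

Definition F9 :=
  t1 * s2 ^+ 2 + s3 ^+ 2 - t2 * s1 * s2
  + s1 * (L123 * u + L124 * v) - s2 * (L125 * u + L126 * v)
  + (L124 * L125 - L123 * L126) * Delta
  - L123 * lam (p1 ^+ 2 + t1 * p2 ^+ 2) (2 * p1 * p3 + 2 * t1 * p2 * p4)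
               (p3 ^+ 2 + t1 * p4 ^+ 2)
  + L124 * mu (p1 ^+ 2 + t1 * p2 ^+ 2) (2 * p1 * p3 + 2 * t1 * p2 * p4)
              (p3 ^+ 2 + t1 * p4 ^+ 2)
  + t2 * L125 * lam (p2 ^+ 2) (2 * p2 * p4) (p4 ^+ 2)
  - t2 * L126 * mu (p2 ^+ 2) (2 * p2 * p4) (p4 ^+ 2)
  + kappa1 * (u ^+ 2 + 2 * t2 * p1 * p2)
  + kappa2 * (u * v + t2 * (p2 * p3 + p1 * p4))
  + kappa3 * (v ^+ 2 + 2 * t2 * p3 * p4).

Definition Fforms : seq A := [:: F1; F2; F3; F4; F5; F6; F7; F8; F9].

Lemma det3 (f : nat -> nat -> A) :
  \det (\matrix_(i < 3, j < 3) f i j)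
  = f 0 0 * (f 1 1 * f 2 2 - f 1 2 * f 2 1)
  - f 0 1 * (f 1 0 * f 2 2 - f 1 2 * f 2 0)
  + f 0 2 * (f 1 0 * f 2 1 - f 1 1 * f 2 0).
Proof.
rewrite (expand_det_row _ ord0) !big_ord_recl big_ord0.
rewrite /cofactor !(expand_det_row _ (ord0 : 'I_2)) !big_ord_recl !big_ord0.
by rewrite /cofactor !det_mx11 !mxE /= /bump /=; ring.
Qed.

Lemma Dminor135 : Dminor 1 3 5 =
  u * ((u + t1 * p2) * u - t2 * p2 * p1)
  + p1 * (- t2 * p2 * u - (- t2 * p1 + t1 * u) * - p1)
  - p2 * (- t2 * p2 * (- t2 * p2) - (- t2 * p1 + t1 * u) * (u + t1 * p2)).
Proof.
pose f i j := nth 0 (nth [::] [:: [:: u; - t2 * p2; - t2 * p1 + t1 * u];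
  [:: - p1; u + t1 * p2; - t2 * p2]; [:: - p2; - p1; u]] i) j.
rewrite /Dminor (_ : colsub _ _ = \matrix_(i, j) f i j) ?det3 /f /=; first ring.
apply/matrixP=> i j; rewrite !mxE inordK; last by case: j => [[|[|[]]]].
by case: i j => [[|[|[]]] // ?] [[|[|[]]] // ?].
Qed.

Lemma Dminor246 : Dminor 2 4 6 =
  v * ((v + t1 * p4) * v - t2 * p4 * p3)
  + p3 * (- t2 * p4 * v - (- t2 * p3 + t1 * v) * - p3)
  - p4 * (- t2 * p4 * (- t2 * p4) - (- t2 * p3 + t1 * v) * (v + t1 * p4)).
Proof.
pose f i j := nth 0 (nth [::] [:: [:: v; - t2 * p4; - t2 * p3 + t1 * v];
  [:: - p3; v + t1 * p4; - t2 * p4]; [:: - p4; - p3; v]] i) j.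
rewrite /Dminor (_ : colsub _ _ = \matrix_(i, j) f i j) ?det3 /f /=; first ring.
apply/matrixP=> i j; rewrite !mxE inordK; last by case: j => [[|[|[]]]].
by case: i j => [[|[|[]]] // ?] [[|[|[]]] // ?].
Qed.

End Formulas.

Section FormulasMorph.
Variables (A B : comNzRingType) (f : {rmorphism A -> B}).

Lemma rmorph_Dminor x i j k : f (Dminor x i j k) = Dminor (f \o x) i j k.
Proof.
rewrite /Dminor -det_map_mx; congr (\det _); apply/matrixP=> r c; rewrite !mxE.
case: r => [[|[|[|//]]] /= _];
  case: (inord _) => [[|[|[|[|[|[|//]]]]]] /= _];
  by rewrite ?rmorphN ?rmorphD ?rmorphM ?rmorphN.
Qed.

Lemma rmorph_Gform x : f (Gform x) = Gform (f \o x).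
Proof. by rewrite /Gform !rmorphD !rmorphM !rmorphD !rmorphM !rmorph_nat !rmorph_Dminor. Qed.

Lemma rmorph_Fforms x s : map f (Fforms x s) = Fforms (f \o x) (f \o s).
Proof.
rewrite /Fforms /=; do ![congr (_ :: _)];
  rewrite /F1 /F2 /F3 /F4 /F5 /F6 /F7 /F8 /F9 /lam /mu /Delta
    /U1 /U2 /U3 /I1 /I2 /I3 /W1 /W2 /W3 /kappa1 /kappa2 /kappa3 /=;
  by rewrite !(rmorphB, rmorphD, rmorphN, rmorphM, rmorph1).
Qed.

End FormulasMorph.

Lemma Fforms0 (A : comNzRingType) :
  {in Fforms (fun=> 0 : A) (fun=> 0), forall g, g = 0}.
Proof.
move=> g; rewrite !inE;
  rewrite /F1 /F2 /F3 /F4 /F5 /F6 /F7 /F8 /F9 /lam /mu /Delta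
    /U1 /U2 /U3 /I1 /I2 /I3 /W1 /W2 /W3 /kappa1 /kappa2 /kappa3 /=.
do ![case/orP=> [/eqP ->|]]; try (move/eqP=> ->); ring.
Qed.

(* Dminor only involves the first 8 coordinates. *)
Lemma eq_Dminor (A : comNzRingType) (x y : 'I_16 -> A) i j k :
  (forall l : 'I_16, (l < 8)%N -> x l = y l) -> Dminor x i j k = Dminor y i j k.
Proof.
move=> xy; rewrite /Dminor; congr (\det (colsub _ _)).
by apply/matrixP=> r c; rewrite !mxE !xy.
Qed.

Definition divides (A : comNzRingType) (d f : A) := exists g, f = g * d.

Definition regular_mod (A : comNzRingType) (d b : A) :=
  forall f, divides d (f * b) -> divides d f.

Section Prime.
Variable B : idomainType.
Implicit Types (d b : B) (f g P : {poly B}).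

Lemma regular_mod_poly d P :
  regular_mod d (lead_coef P) -> regular_mod d%:P P.
Proof.
move=> dP f; have [P0 _|P0] := eqVneq P 0.
  have [|g g1] := dP 1; first by exists 0; rewrite P0 lead_coef0 mulr0 mul0r.
  by exists (f * g%:P); rewrite -mulrA -polyCM -g1 mulr1.
have [n] := ubnP (size f); elim: n f => // n IHn f.
have [-> _ _|f0] := eqVneq f 0; first by exists 0; rewrite mul0r.
rewrite ltnS => szf [g fPg].
have [c lfc] : divides d (lead_coef f).
  apply: dP; exists g`_(size f + size P).-2.
  by rewrite -lead_coefM -coefMC -fPg lead_coefE size_mul //.
set f' := f - lead_coef f *: 'X^((size f).-1).
have szf' : (size f' < n)%N.
  apply: leq_trans szf; rewrite -(prednK (_ : 0 < size f)%N) ?size_poly_gt0 //.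
  rewrite ltnS; apply/leq_sizeP=> j; rewrite leq_eqVlt => /predU1P[<-|lt_j].
    by rewrite !coefE eqxx mulr1 subrr.
  rewrite !coefE gtn_eqF // mulr0 subr0 nth_default //.
  by rewrite -ltnS prednK ?size_poly_gt0 in lt_j.
have [|g' f'g'] := IHn f' szf'.
  exists (g - c *: 'X^((size f).-1) * P).
  rewrite /f' lfc mulrBl fPg mulrBl; congr (_ - _).
  by rewrite mulrAC; congr (_ * _); rewrite -!mul_polyC polyCM mulrAC.
exists (g' + c *: 'X^((size f).-1)).
rewrite mulrDl -f'g' /f' lfc -!mul_polyC polyCM mulrAC.
by rewrite [in RHS]mulrAC subrK.
Qed.

Lemma linear_prime d b : d != 0 -> regular_mod d b ->
  forall f g, let P := d%:P * 'X + b%:P in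
  divides P (f * g) -> divides P f \/ divides P g.
Proof.
move=> d0 db f0 g0 P.
have szP : size P = 2%N.
  by rewrite size_MXaddC polyC_eq0 (negPf d0) size_polyC d0.
have reduce f : exists k q r, d%:P ^+ k * f = q * P + r%:P.
  elim/poly_ind: f => [|f c [k [q [r IH]]]].
    by exists 0%N, 0, 0; rewrite mulr0 mul0r addr0.
  exists k.+1, (d%:P * q * 'X + r%:P), (d ^+ k.+1 * c - r * b).
  rewrite polyCB !polyCM polyC_exp.
  transitivity (d%:P * 'X * (d%:P ^+ k * f) + d%:P ^+ k.+1 * c%:P).
    by rewrite exprS; ring.
  by rewrite IH /P; ring.
have const r : divides P r%:P -> r = 0.
  case=> q; have [->|q0] := eqVneq q 0.
    by rewrite mul0r => /eqP; rewrite polyC_eq0 => /eqP.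
  move/(congr1 (size : {poly B} -> nat)).
  rewrite size_mul // -?size_poly_gt0 szP // addn2 /= size_polyC => e.
  have := leq_b1 (r != 0); rewrite e ltnS leqNgt size_poly_gt0 q0 //.
have cancel1 f : divides P (d%:P * f) -> divides P f.
  case=> q dfq; have [q' qq'] : divides d%:P q.
    apply: (@regular_mod_poly d b%:P); first by rewrite lead_coefC.
    exists (f - q * 'X); rewrite mulrBl [f * _]mulrC dfq /P; ring.
  exists q'; apply: (@mulfI _ d%:P); first by rewrite polyC_eq0.
  by rewrite dfq qq'; ring.
have cancel k f : divides P (d%:P ^+ k * f) -> divides P f.
  elim: k => [|k IHk]; first by rewrite mul1r.
  by rewrite exprS -mulrA => /cancel1.
have [k [q1 [r fr]]] := reduce f0; have [l [q2 [s gs]]] := reduce g0.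
case=> q fgq; have /const/eqP : divides P (r * s)%:P.
  exists (d%:P ^+ k * d%:P ^+ l * q - q1 * (q2 * P + s%:P) - r%:P * q2).
  transitivity ((q1 * P + r%:P) * (q2 * P + s%:P)
    - (q1 * (q2 * P + s%:P) + r%:P * q2) * P).
    by rewrite polyCM; ring.
  rewrite -fr -gs; transitivity (d%:P ^+ k * d%:P ^+ l * (f0 * g0)
    - (q1 * (d%:P ^+ l * g0) + r%:P * q2) * P); first by ring.
  by rewrite fgq gs; ring.
rewrite mulf_eq0 => /orP[]/eqP z0; [left|right].
  by apply: (cancel k); exists q1; rewrite fr z0 addr0.
by apply: (cancel l); exists q2; rewrite gs z0 addr0.
Qed.

Lemma linear_prime_transfer (A : comNzRingType)
    (phi : {rmorphism A -> {poly B}}) (psi : {rmorphism {poly B} -> A})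
    (G : A) d b :
  cancel phi psi -> phi G = d%:P * 'X + b%:P -> d != 0 -> regular_mod d b ->
  forall f g : A, divides G (f * g) -> divides G f \/ divides G g.
Proof.
move=> phiK phiG d0 db f g [h fgh].
have := linear_prime d0 db (f := phi f) (g := phi g).
rewrite /= -phiG => key; have [|[k fk]|[k gk]] := key.
- by exists (phi h); rewrite -!rmorphM fgh.
- by left; exists (psi k); rewrite -[f]phiK fk rmorphM phiK.
- by right; exists (psi k); rewrite -[g]phiK gk rmorphM phiK.
Qed.

Lemma lead_cubic (a1 a2 b1 b2 : B) (c := @polyC B) : lead_coef
  ('X * (('X + c b1 * c a2) * 'X - c b2 * c a2 * c a1)
  + c a1 * (- c b2 * c a2 * 'X - (- c b2 * c a1 + c b1 * 'X) * - c a1)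
  - c a2 * (- c b2 * c a2 * (- c b2 * c a2)
            - (- c b2 * c a1 + c b1 * 'X) * ('X + c b1 * c a2))) = 1.
Proof.
rewrite (_ : _ - _ = 'X^3 + (c (2 * b1 * a2) * 'X^2
  + (c (- 3 * b2 * a2 * a1 + a1 ^+ 2 * b1 + b1 ^+ 2 * a2 ^+ 2) * 'X
  + c (- b2 * a1 ^+ 3 - b1 * b2 * a1 * a2 ^+ 2 - b2 ^+ 2 * a2 ^+ 3)))).
  rewrite lead_coefDl ?lead_coefXn // size_polyXn ltnS.
  rewrite (leq_trans (size_polyD _ _)) // geq_max.
  rewrite (leq_trans (size_polyMleq _ _)) /=; last first.
    by rewrite size_polyXn addn3 /= !ltnS size_polyC leq_b1.
  rewrite (leq_trans (size_polyD _ _)) // geq_max.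
  rewrite (leq_trans (size_polyMleq _ _)) /=; last first.
    by rewrite size_polyX addn2 /= ltnS size_polyC; case: (_ != 0).
  by rewrite size_polyC; case: (_ != 0).
by rewrite /c; ring.
Qed.

End Prime.

(* The ideal (G) is prime: G is linear in L246, with coefficient D_246 and      *)
(* constant term regular modulo D_246.                                        *)
Module GPrime.
Section GPrime.
Variable K : idomainType.

Local Notation o i := (@Ordinal 16 i isT).

Lemma Gform_L135 (A : comNzRingType) (x y : 'I_16 -> A) :
  (forall i, i != o 12 -> x i = y i) -> y (o 12) = 0 ->
  Gform x = Dminor x 1 3 5 * x (o 12) + Gform y.
Proof.
move=> xy y0; rewrite /Gform y0 -!xy //.
have e i j k : Dminor y i j k = Dminor x i j k.
  by apply: eq_Dminor => l l8; rewrite xy // neq_ltn (leq_trans l8).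
by rewrite !e; ring.
Qed.

Lemma Gform_L246 (A : comNzRingType) (x y : 'I_16 -> A) :
  (forall i, i != o 15 -> x i = y i) -> y (o 15) = 0 ->
  Gform x = Dminor x 2 4 6 * x (o 15) + Gform y.
Proof.
move=> xy y0; rewrite /Gform y0 -!xy //.
have e i j k : Dminor y i j k = Dminor x i j k.
  by apply: eq_Dminor => l l8; rewrite xy // neq_ltn (leq_trans l8).
by rewrite !e; ring.
Qed.

Local Notation B := ({mpoly K[13]} : idomainType).
Local Notation T1 := ({poly B} : idomainType).
Local Notation T2 := ({poly T1} : idomainType).

(* Coordinates 4, 12 and 15 (u, L135 and L246) are made polynomial variables. *)
Definition c (i : 'I_16) : 'I_13 :=
  inord (if (i < 4)%N then i : nat else if (i < 12)%N then i.-1 else i.-2).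
Definition q (i : 'I_16) : B := if i \in [:: o 4; o 12; o 15] then 0 else 'X_(c i).
Definition w (i : 'I_16) : T1 := if i == o 4 then 'X else (q i)%:P.
Definition z (i : 'I_16) : T2 := if i == o 12 then 'X else (w i)%:P.
Definition y (i : 'I_16) : {poly T2} :=
  if i == o 15 then 'X else (z i)%:P.

Definition phi : {rmorphism {mpoly K[16]} -> {poly T2}} :=
  mmap (polyC \o polyC \o polyC \o @mpolyC 13 K) y.

Definition c' (k : 'I_13) : 'I_16 :=
  inord (if (k < 4)%N then k : nat else if (k < 11)%N then k.+1 else k.+2).
Local Notation S := {mpoly K[16]}.
Definition psi0 : {rmorphism B -> S} := mmap (@mpolyC 16 K) (fun k => 'X_(c' k)).
Definition psi1 : {rmorphism T1 -> S} :=
  horner_morph (fun f => mulrC 'X_(o 4) (psi0 f)).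
Definition psi2 : {rmorphism T2 -> S} :=
  horner_morph (fun f => mulrC 'X_(o 12) (psi1 f)).
Definition psi : {rmorphism {poly T2} -> S} :=
  horner_morph (fun f => mulrC 'X_(o 15) (psi2 f)).

Lemma phiX i : phi 'X_i = y i. Proof. by rewrite /= mmapX mmap1U. Qed.

Lemma phiC a : phi a%:MP = a%:MP%:P%:P%:P.
Proof. by rewrite /= mmapC. Qed.
Lemma psi0C a : psi0 a%:MP = a%:MP.
Proof. by rewrite /= mmapC. Qed.
Lemma psi1C f : psi1 f%:P = psi0 f. Proof. exact: horner_morphC. Qed.
Lemma psi1X : psi1 'X = 'X_(o 4). Proof. exact: horner_morphX. Qed.
Lemma psi2C f : psi2 f%:P = psi1 f. Proof. exact: horner_morphC. Qed.
Lemma psi2X : psi2 'X = 'X_(o 12). Proof. exact: horner_morphX. Qed.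
Lemma psiC f : psi f%:P = psi2 f. Proof. exact: horner_morphC. Qed.
Lemma psiX : psi 'X = 'X_(o 15). Proof. exact: horner_morphX. Qed.

Lemma phiK : cancel phi psi.
Proof.
have psiy i : psi (y i) = 'X_i.
  rewrite /y; case: eqP => [->|/eqP i15]; first exact: psiX.
  rewrite psiC /z; case: eqP => [->|/eqP i12]; first exact: psi2X.
  rewrite psi2C /w; case: eqP => [->|/eqP i4]; first exact: psi1X.
  rewrite psi1C /q !inE (negPf i4) (negPf i12) (negPf i15) /=.
  rewrite mmapX mmap1U; congr 'X__; apply/val_inj.
  case: i i15 i12 i4 => i lti /= i15 i12 i4; rewrite /c /c' /=.
  rewrite -!val_eqE /= in i15 i12 i4.
  have [i_lt4|i_ge4] := ltnP i 4.
    by rewrite !(@inordK 12 i) ?i_lt4 ?inordK; lia.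
  have [i_lt12|i_ge12] := ltnP i 12.
    have -> : @inord 12 i.-1 = i.-1 :> nat by rewrite inordK; lia.
    have -> : (i.-1 < 4)%N = false by lia.
    have -> : (i.-1 < 11)%N by lia.
    by rewrite inordK; lia.
  have -> : @inord 12 i.-2 = i.-2 :> nat by rewrite inordK; lia.
  have -> : (i.-2 < 4)%N = false by lia.
  have -> : (i.-2 < 11)%N = false by lia.
  by rewrite inordK; lia.
move=> p; rewrite [in LHS](mpolyE p) (rmorph_sum phi) (rmorph_sum psi) [RHS]mpolyE.
apply: eq_bigr => m _; rewrite -mul_mpolyC mpolyXE_id.
rewrite (rmorphM phi) (rmorphM psi) (rmorph_prod phi) (rmorph_prod psi).
congr (_ * _).
  by rewrite phiC psiC psi2C psi1C psi0C.
by apply: eq_bigr => i _; rewrite (rmorphXn phi) (rmorphXn psi) phiX psiy.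
Qed.

Lemma lead_D135 : lead_coef (Dminor w 1 3 5) = 1.
Proof. by rewrite Dminor135 /w /= lead_cubic. Qed.

Lemma D246_neq0 : Dminor q 2 4 6 != 0.
Proof.
pose e (k : 'I_13) : K := (k == inord 4)%:R.
apply: contra_neq (oner_neq0 K) => /(congr1 (meval e)).
rewrite rmorph0 (rmorph_Dminor (meval e)) Dminor246 /= /q !inE /=.
rewrite !mevalXU /e /c -!val_eqE /= !inordK //=.
by move=> <-; ring.
Qed.

Lemma Gform_prime (f g : S) (G := Gform (fun i => 'X_i : S)) :
  divides G (f * g) -> divides G f \/ divides G g.
Proof.
have phiG : phi G = (Dminor z 2 4 6)%:P * 'X + (Gform z)%:P.
  have yE i : phi 'X_i = y i by exact: phiX.
  rewrite /G (rmorph_Gform phi) (_ : phi \o _ = y); last exact/funext/yE.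
  rewrite (rmorph_Gform polyC) (rmorph_Dminor polyC).
  have yz i : i != o 15 -> y i = (polyC \o z) i.
    by rewrite /y => /negPf ->.
  have y15 : y (o 15) = 'X by rewrite /y eqxx.
  have z15 : (polyC \o z) (o 15) = 0 by rewrite /= /z /w /q !inE /= !polyC0.
  rewrite (Gform_L246 yz z15) y15 (@eq_Dminor _ y (polyC \o z)) // => l l8.
  by rewrite yz // neq_ltn (leq_trans l8).
have Gz : Gform z = (Dminor w 1 3 5)%:P * 'X + (Gform w)%:P.
  rewrite (rmorph_Gform polyC) (rmorph_Dminor polyC).
  have zw i : i != o 12 -> z i = (polyC \o w) i.
    by rewrite /z => /negPf ->.
  have z12 : z (o 12) = 'X by rewrite /z eqxx.
  have w12 : (polyC \o w) (o 12) = 0 by rewrite /= /w /q !inE /= polyC0.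
  rewrite (Gform_L135 zw w12) z12 (@eq_Dminor _ z (polyC \o w)) // => l l8.
  by rewrite zw // neq_ltn (leq_trans l8).
have Dz : Dminor z 2 4 6 = (Dminor q 2 4 6)%:P%:P.
  by rewrite (rmorph_Dminor polyC) (rmorph_Dminor polyC) !Dminor246.
have main : regular_mod (Dminor z 2 4 6) (Gform z).
  rewrite Dz Gz; apply: regular_mod_poly.
  have D0 : Dminor w 1 3 5 != 0 by rewrite -lead_coef_eq0 lead_D135 oner_eq0.
  have -> : lead_coef ((Dminor w 1 3 5)%:P * 'X + (Gform w)%:P)
            = Dminor w 1 3 5.
    rewrite lead_coefDl ?lead_coefM ?lead_coefX ?mulr1 ?lead_coefC //.
    rewrite size_mulX ?polyC_eq0 // !size_polyC D0.
    by case: (_ == _).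
  apply: regular_mod_poly; rewrite lead_D135 => r.
  by rewrite mulr1.
have D0 : Dminor z 2 4 6 != 0 by rewrite Dz !polyC_eq0 D246_neq0.
exact: (linear_prime_transfer phiK phiG D0 main).
Qed.

End GPrime.
End GPrime.

Section GformVanish.
Local Notation o i := (@Ordinal 16 i isT).

Lemma Gform_ID (A : comNzRingType) (x : 'I_16 -> A) w :
  x (o 4) = w * x (o 0) + w ^+ 2 * x (o 1) ->
  x (o 5) = w * x (o 2) + w ^+ 2 * x (o 3) ->
  x (o 7) = w ^+ 3 + x (o 6) * w -> Gform x = 0.
Proof.
move=> u v t2.
pose f (i j k : nat) (a b : nat) := nth 0 (nth [::]
  [:: [:: x (o 4); x (o 5); - x (o 7) * x (o 1); - x (o 7) * x (o 3); - x (o 7) * x (o 0) + x (o 6) * x (o 4); - x (o 7) * x (o 2) + x (o 6) * x (o 5)];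
      [:: - x (o 0); - x (o 2); x (o 4) + x (o 6) * x (o 1); x (o 5) + x (o 6) * x (o 3); - x (o 7) * x (o 1); - x (o 7) * x (o 3)];
      [:: - x (o 1); - x (o 3); - x (o 0); - x (o 2); x (o 4); x (o 5)]] a) (nth 0%N [:: i; j; k] b).-1.
have D i j k : (i.-1 < 6)%N -> (j.-1 < 6)%N -> (k.-1 < 6)%N -> Dminor x i j k = \det (\matrix_(a < 3, b < 3) f i j k a b).
  move=> ? ? ?; congr (\det _); apply/matrixP=> r c; rewrite !mxE inordK //.
  by case: c => [[|[|[|]]]].
by rewrite /Gform !D // !det3 /f /= u v t2; ring.
Qed.

End GformVanish.

Section IdealGen.
Variable A : comNzRingType.

Definition ideal_gen (s : seq A) : {pred A} :=
  [pred f | `[< exists a : 'I_(size s) -> A, f = \sum_i a i * s`_i >]].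

(* f witnesses that the ideal is proper. *)
Lemma ideal_gen_closed (s : seq A) (K : comNzRingType) (f : {rmorphism A -> K}) :
  (forall g, g \in s -> f g = 0) -> idealr_closed (ideal_gen s).
Proof.
move=> fs; split.
- by apply/asboolP; exists (fun=> 0); rewrite big1 // => i _; rewrite mul0r.
- apply/asboolPn => -[a] /(congr1 f) /eqP.
  rewrite rmorph1 rmorph_sum big1 ?oner_eq0 // => i _.
  by rewrite rmorphM (fs _ (mem_nth _ (ltn_ord i))) mulr0.
- move=> b x y /asboolP[a1 ->] /asboolP[a2 ->]; apply/asboolP.
  exists (fun i => b * a1 i + a2 i).
  by rewrite mulr_sumr -big_split; apply: eq_bigr => i _; rewrite mulrDl mulrA.
Qed.

Lemma mem_ideal_gen1 (G f : A) : (f \in ideal_gen [:: G]) <-> divides G f.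
Proof.
split=> [/asboolP[a ->]|[g ->]]; first by exists (a ord0); rewrite big_ord1.
by apply/asboolP; exists (fun=> g); rewrite big_ord1.
Qed.

End IdealGen.

Notation SG R := {mpoly (complex R)[16]}.
(* The variables of SGt are p1, p2, p3, p4, t1, w, L123, ..., L246, in order. *)
Notation SGt R := {mpoly (complex R)[14]}.
Notation SPi R := {mpoly (SG R)[3]}.

Section Unprojection.
Variable R : realType.
Local Open Scope quotient_scope.
Local Open Scope complex_scope.
Local Open Scope classical_set_scope.

Local Notation SG := (SG R).
Local Notation SGt := (SGt R).
Local Notation SPi := (SPi R).

Definition Gpoly : SG := Gform (fun i => 'X_i).

Definition PiGens : seq SPi := Fforms (fun i => ('X_i)%:MP) (fun j => 'X_j).

Definition xt (k : nat) : SGt := 'X_(inord k).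

Definition hvals : 16.-tuple SGt :=
  let p1 := xt 0 in let p2 := xt 1 in let p3 := xt 2 in let p4 := xt 3 in
  let t1 := xt 4 in let w := xt 5 in
  [tuple p1; p2; p3; p4;
         w * p1 + w ^+ 2 * p2; w * p3 + w ^+ 2 * p4; t1; w ^+ 3 + t1 * w;
         xt 6; xt 7; xt 8; xt 9; xt 10; xt 11; xt 12; xt 13].

Definition h_map : {rmorphism SG -> SGt} := comp_mpoly hvals.

Definition ID : set SG := [set f | h_map f = 0].

Definition Gideal : {pred SG} := ideal_gen [:: Gpoly].
Definition Piideal : {pred SPi} := ideal_gen PiGens.

Lemma Gideal_closed : idealr_closed Gideal.
Proof.
apply: (@ideal_gen_closed _ _ _ (meval (fun=> 0))) => g.
rewrite inE => /eqP ->; rewrite rmorph_Gform /Gform /=.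
by rewrite !mevalXU !mul0r !addr0.
Qed.

Lemma Gideal_prime : prime_idealr_closed Gideal.
Proof.
move=> f g /mem_ideal_gen1 /GPrime.Gform_prime[] fG; apply/orP; [left|right];
  exact/mem_ideal_gen1.
Qed.

Lemma Piideal_closed : idealr_closed Piideal.
Proof.
pose ev : {rmorphism SPi -> R[i]} := meval (fun=> 0) \o meval (fun=> 0).
have ev_s i : ev 'X_i = 0 by rewrite /= mevalXU rmorph0.
have ev_x i : ev ('X_i)%:MP = 0 by rewrite /= mevalC mevalXU.
apply: (@ideal_gen_closed _ _ _ ev) => g /(map_f ev).
rewrite rmorph_Fforms (_ : ev \o _ = fun=> 0); last exact/funext/ev_x.
by rewrite (_ : ev \o _ = fun=> 0); [exact: Fforms0 | exact/funext/ev_s].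
Qed.

HB.instance Definition _ := isIdealr.Build SG Gideal Gideal_closed.
HB.instance Definition _ := isPrimeIdealrClosed.Build SG Gideal Gideal_prime.
HB.instance Definition _ := isIdealr.Build SPi Piideal Piideal_closed.

Definition RG := {ideal_quot Gideal}.
HB.instance Definition _ := GRing.ComNzRing.on RG.

Definition RPi := {ideal_quot Piideal}.
HB.instance Definition _ := GRing.ComNzRing.on RPi.

(* R_G is an integral domain; the inverses of its units come from choice. *)
Definition RG_inv (x : RG) : RG :=
  if pselect (exists y, y * x = 1) is left e then sval (cid e) else x.

Fact RG_mulVr : {in [pred x : RG | `[< exists y, y * x = 1 >]],
  left_inverse 1 RG_inv *%R}.
Proof.
move=> x /asboolP e; rewrite /RG_inv; case: pselect => // e'.
exact: (svalP (cid e')).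
Qed.

Fact RG_unitPl (x y : RG) :
  y * x = 1 -> [pred x : RG | `[< exists y, y * x = 1 >]] x.
Proof. by move=> yx; apply/asboolP; exists y. Qed.

Fact RG_inv_out :
  {in [predC [pred x : RG | `[< exists y, y * x = 1 >]]], RG_inv =1 id}.
Proof. by move=> x /asboolPn e; rewrite /RG_inv; case: pselect. Qed.

HB.instance Definition _ :=
  GRing.ComNzRing_hasMulInverse.Build RG RG_mulVr RG_unitPl RG_inv_out.
HB.instance Definition _ := GRing.ComUnitRing_isIntegral.Build RG
  (@Quotient.rquot_IdomainAxiom _ Gideal).

Definition QG := {fraction RG}.
HB.instance Definition _ := GRing.Field.on QG.

Definition piG : {rmorphism SG -> RG} := \pi_RG.
Definition piPi : {rmorphism SPi -> RPi} := \pi_RPi.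
Definition fracG : {rmorphism RG -> QG} := @tofrac RG.

Lemma Gpoly_in_ID : ID Gpoly.
Proof.
rewrite /ID /= (rmorph_Gform h_map) (@Gform_ID _ _ (xt 5)) //;
  by rewrite /= !comp_mpolyXU.
Qed.

(* The ideal I_D / (G), as the image of I_D in R_G; G is in I_D by the above. *)
Definition JD : set RG := [set piG f | f in ID].

Definition JDinv : set QG :=
  [set f | forall x, JD x -> range fracG (f * fracG x)].

Definition unprojection_ring : set QG :=
  smallest [set A : set QG | GRing.subring_closed [pred x | x \in A]]
           (range fracG `|` JDinv).

End Unprojection.

Arguments ID : clear implicits.
Arguments JD : clear implicits.
Arguments JDinv : clear implicits.
Arguments unprojection_ring : clear implicits.

(* Main.v *)
(* Write w^k |-> s_(k+1) for k < 3, extended to S_G[w] by the relation           *)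
(* w^3 + t_1 w = t_2. The ideal of D~ in S_G[w] is generated by u - p_1 w -      *)
(* p_2 w^2, v - p_3 w - p_4 w^2 and w^3 + t_1 w - t_2, and F1, ..., F6 say that  *)
(* this linear map sends it into S_G, while F7, F8, F9 straighten products of    *)
(* the s_i: every element of R_Pi is a sum of terms s_1^n l(f_n), where l is the *)
(* linear map, plus a constant. In Q_G the s_i are given by Cramer's rule on     *)
(* F1, F2, F3; the other F's follow by syzygies and Delta <> 0.                  *)
(* - Injectivity of R_Pi -> Q_G: multiply by g^n with g in I_D and restrict to   *)
(*   D~; the leading f_n then vanishes on D~ and can be absorbed.                *)
(* - J_D^-1 = R_G + l(S_G[w]): the quotient of the restrictions to D~ of f g and *)
(*   s_1 g does not depend on g in I_D, and it is regular because those for      *)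
(*   s_1 D_123 and s_1 D_135 form a regular sequence; subtracting a value of l   *)
(*   one may assume it is 0. Then f s_1 also maps J_D to R_G, and f is in R_G    *)
(*   because D_246, s_1 D_135 and G form a regular sequence.                     *)

From HB Require Import structures.
Require Import Defs.
From mathcomp Require Import all_boot all_order all_algebra.
From mathcomp Require Import generic_quotient ring_quotient fraction complex.
From mathcomp Require Import boolp classical_sets reals mpoly ring.

Set Implicit Arguments.
Unset Strict Implicit.
Unset Printing Implicit Defensive.

Import GRing.Theory.
Local Open Scope ring_scope.

(** D~ = Spec S~_G parametrises D, and S~_G is S_G[w] modulo [cubic_relations] ([h_liftK],
    [h_ext_kernel]). The s_i behave like rational functions on Spec R_G with a simple pole along D,
    their polar parts being in the ratio 1 : w : w^2 after pullback to D~ ([residue_cubic_seq]).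
    Hence l = [lin_ext] produces from f in S_G[w] a function whose polar part is f times that of
    s_1. F1, ..., F6 say exactly that this function has no pole when f vanishes on D~
    ([lin_ext_ideal]).

    The F's have a solution in Q_G ([Fforms_solvable]), which gives a map from R_Pi to Q_G. It is
    injective: [pole_le] filters R_Pi by pole order, by F7, F8, F9 every element has finite order
    ([pole_le_s]), and an element mapped to 0 can have its order lowered until it comes from S_G
    ([pole_le_injective]).

    Its image contains J_D^-1: the polar part of q in J_D^-1 is a regular function on D~ times that
    of s_1, so some l(f) removes it, and what remains has no pole ([inverse_ideal]). The two
    extension arguments behind this rest on the regular sequences of [regular_residues] on D~ and
    [regular_G] on S_G. Conversely the s_i lie in J_D^-1 ([img_cubic_seq]). [unprojection_embedding]
    assembles these facts, and R_Pi is a domain because it embeds in a field. *)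

Local Notation o i := (@Ordinal 16 i isT).
Local Notation o14 i := (@Ordinal 14 i isT).
Local Notation o3 i := (@Ordinal 3 i isT).

(** * Syzygies between G, the minors of M and the F's *)

Section Identities.
Variables (A : comNzRingType) (x : 'I_16 -> A) (s : 'I_3 -> A).

Local Notation p1 := (x (o 0)).
Local Notation p2 := (x (o 1)).
Local Notation p3 := (x (o 2)).
Local Notation p4 := (x (o 3)).
Local Notation u := (x (o 4)).
Local Notation v := (x (o 5)).
Local Notation t1 := (x (o 6)).
Local Notation t2 := (x (o 7)).
Local Notation L123 := (x (o 8)).
Local Notation L124 := (x (o 9)).
Local Notation L125 := (x (o 10)).
Local Notation L126 := (x (o 11)).
Local Notation s1 := (s (@Ordinal 3 0 isT)).
Local Notation s2 := (s (@Ordinal 3 1 isT)).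
Local Notation s3 := (s (@Ordinal 3 2 isT)).

Definition Mentry (i j : nat) : A := nth 0 (nth [::]
  [:: [:: u; v; - t2 * p2; - t2 * p4; - t2 * p1 + t1 * u; - t2 * p3 + t1 * v];
      [:: - p1; - p3; u + t1 * p2; v + t1 * p4; - t2 * p2; - t2 * p4];
      [:: - p2; - p4; - p1; - p3; u; v]] i) j.

Lemma DminorE i j k : (i.-1 < 6)%N -> (j.-1 < 6)%N -> (k.-1 < 6)%N ->
  Dminor x i j k =
    Mentry 0 i.-1 * (Mentry 1 j.-1 * Mentry 2 k.-1 - Mentry 1 k.-1 * Mentry 2 j.-1)
  - Mentry 0 j.-1 * (Mentry 1 i.-1 * Mentry 2 k.-1 - Mentry 1 k.-1 * Mentry 2 i.-1)
  + Mentry 0 k.-1 * (Mentry 1 i.-1 * Mentry 2 j.-1 - Mentry 1 j.-1 * Mentry 2 i.-1).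
Proof.
move=> i6 j6 k6.
rewrite -(det3 (fun r c => Mentry r (nth 0 [:: i; j; k] c).-1)).
congr (\det _); apply/matrixP=> r c; rewrite !mxE inordK //.
by case: c => [[|[|[|]]]].
Qed.

Ltac unfoldF := rewrite /Gform /F1 /F2 /F3 /F4 /F5 /F6 /F7 /F8 /F9 ?DminorE //
  /Mentry /lam /mu /Delta /U1 /U2 /U3 /I1 /I2 /I3 /W1 /W2 /W3
  /kappa1 /kappa2 /kappa3 /=.

(** The s_i cancel on the right, so G lies in the ideal of the F's and dies in R_Pi. *)
Lemma Gform_syzygy : Gform x =
  p3 * (t2 * F1 x s - t1 * F3 x s) + p4 * (t2 * F3 x s - t1 * F5 x s)
  - v * F5 x s - p1 * (t2 * F2 x s - t1 * F4 x s)
  - p2 * (t2 * F4 x s - t1 * F6 x s) + u * F6 x s.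
Proof. by unfoldF; ring. Qed.

(** The linear parts of F1, ..., F4 pair s with the first four columns of M. Four vectors of length
    3 satisfy the relation with the 3 x 3 minors as coefficients, and the constant terms leave Delta
    G. So F4 follows from F1, F2, F3 where G = 0 and D_123 is invertible. *)
Lemma plucker_syzygy :
  Dminor x 1 2 3 * F4 x s = Delta x * Gform x
  + Dminor x 1 2 4 * F3 x s - Dminor x 1 3 4 * F2 x s + Dminor x 2 3 4 * F1 x s.
Proof. by unfoldF; ring. Qed.

(** This and the next four identities show that F5, ..., F9 follow from F1, ..., F4 where Delta is
    invertible. *)
Lemma Delta_F5 : Delta x * F5 x s =
  U1 x * F4 x s - (p1 * p3 + t1 * p2 * p4 + p2 * v) * F3 x s
  - I1 x * F2 x s + (t2 * p2 * p4 + p1 * v) * F1 x s.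
Proof. by unfoldF; ring. Qed.

Lemma Delta_F6 : Delta x * F6 x s =
  (p1 * p3 + t1 * p2 * p4 + p4 * u) * F4 x s - U3 x * F3 x s
  - (t2 * p2 * p4 + p3 * u) * F2 x s + I3 x * F1 x s.
Proof. by unfoldF; ring. Qed.

Lemma Delta_F7 : Delta x * F7 x s =
  (p2 * s1 + lam x (p2 ^+ 2) (2 * p2 * p4) (p4 ^+ 2)) * F4 x s
  - (p4 * s1 - mu x (p2 ^+ 2) (2 * p2 * p4) (p4 ^+ 2)) * F3 x s
  - (p2 * s2 + lam x (p1 * p2) (p2 * p3 + p1 * p4) (p3 * p4)) * F2 x s
  + (p4 * s2 - mu x (p1 * p2) (p2 * p3 + p1 * p4) (p3 * p4)) * F1 x s.
Proof. by unfoldF; ring. Qed.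

Lemma Delta_F8 : Delta x * F8 x s =
  (p1 * s1 + lam x (p1 * p2) (p1 * p4 + p2 * p3) (p3 * p4)) * F4 x s
  - (p3 * s1 - mu x (p1 * p2) (p1 * p4 + p2 * p3) (p3 * p4)) * F3 x s
  - (p1 * s2 + lam x (p1 ^+ 2) (2 * p1 * p3) (p3 ^+ 2)) * F2 x s
  + (p3 * s2 - mu x (p1 ^+ 2) (2 * p1 * p3) (p3 ^+ 2)) * F1 x s.
Proof. by unfoldF; ring. Qed.

Lemma Delta_F9 : exists a b c d, Delta x * F9 x s =
  a * F4 x s + b * F3 x s + c * F2 x s + d * F1 x s.
Proof.
(* The second and fourth coefficients contain [F2] and [F4] themselves: the identity is quadratic in
   the F's. *)
exists (u * s1 - lam x (p1 ^+ 2 + t1 * p2 ^+ 2)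
          (2 * p1 * p3 + 2 * t1 * p2 * p4) (p3 ^+ 2 + t1 * p4 ^+ 2)
        - L126 * Delta x).
exists (F2 x s - L125 * Delta x
        - (v * s1 + mu x (p1 ^+ 2 + t1 * p2 ^+ 2)
          (2 * p1 * p3 + 2 * t1 * p2 * p4) (p3 ^+ 2 + t1 * p4 ^+ 2))).
exists (t2 * lam x (p2 ^+ 2) (2 * p2 * p4) (p4 ^+ 2) - u * s2 + L124 * Delta x).
exists (v * s2 + t2 * mu x (p2 ^+ 2) (2 * p2 * p4) (p4 ^+ 2)
        - (F4 x s - L123 * Delta x)).
by unfoldF; ring.
Qed.

Let z : 'I_3 -> A := fun=> 0.

Lemma F1_linear : F1 x s = u * s1 - p1 * s2 - p2 * s3 + F1 x z.
Proof. by rewrite /F1 /z; ring. Qed.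

Lemma F2_linear : F2 x s = v * s1 - p3 * s2 - p4 * s3 + F2 x z.
Proof. by rewrite /F2 /z; ring. Qed.

Lemma F3_linear : F3 x s =
  - t2 * p2 * s1 + (u + t1 * p2) * s2 - p1 * s3 + F3 x z.
Proof. by rewrite /F3 /z; ring. Qed.

Lemma F4_linear : F4 x s =
  - t2 * p4 * s1 + (v + t1 * p4) * s2 - p3 * s3 + F4 x z.
Proof. by rewrite /F4 /z; ring. Qed.

Lemma F5_linear : F5 x s =
  - t2 * p1 * s1 + (t1 * p1 - t2 * p2) * s2 + (u + t1 * p2) * s3 + F5 x z.
Proof. by rewrite /F5 /z; ring. Qed.

Lemma F6_linear : F6 x s =
  - t2 * p3 * s1 + (t1 * p3 - t2 * p4) * s2 + (v + t1 * p4) * s3 + F6 x z.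
Proof. by rewrite /F6 /z; ring. Qed.

(** Here and in the next two lemmas t_2 s_1 - t_1 s_2 and t_2 s_2 - t_1 s_3 are grouped because they
    are l(w^3) and l(w^4). The quadratic parts then compare s_(a+1) s_(b+1) with s_1 l(w^(a+b)). *)
Lemma F7_quadratic : F7 x s = s1 * s3 - s2 * s2
  + (L123 * p2 + L124 * p4) * s1 - (L125 * p2 + L126 * p4) * s2 + F7 x z.
Proof. by rewrite /F7 /z; ring. Qed.

Lemma F8_quadratic : F8 x s = s2 * s3 - s1 * (t2 * s1 - t1 * s2)
  + (L123 * p1 + L124 * p3) * s1 - (L125 * p1 + L126 * p3) * s2 + F8 x z.
Proof. by rewrite /F8 /z; ring. Qed.

Lemma F9_quadratic : F9 x s =
  s3 * s3 - s1 * (t2 * s2 - t1 * s3) - t1 * (s1 * s3 - s2 * s2)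
  + (L123 * u + L124 * v) * s1 - (L125 * u + L126 * v) * s2 + F9 x z.
Proof. by rewrite /F9 /z; ring. Qed.

End Identities.

(** * Finitely generated ideals and regular elements modulo them *)

Section Ideals.
Variable A : comNzRingType.
Implicit Types (a b c f g : A) (gs : seq A).

(** One existential per generator lets a single generator be moved or exchanged without handling
    sums. *)
Fixpoint in_ideal gs f : Prop :=
  if gs is g :: gs' then exists a, in_ideal gs' (f - a * g) else f = 0.

Lemma in_idealD gs f g : in_ideal gs f -> in_ideal gs g -> in_ideal gs (f + g).
Proof.
elim: gs f g => [|h gs IH] f g /=; first by move=> -> ->; rewrite addr0.
by move=> [a fa] [b gb]; exists (a + b); rewrite mulrDl opprD addrACA; exact: IH.
Qed.

Lemma in_idealM gs c f : in_ideal gs f -> in_ideal gs (c * f).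
Proof.
elim: gs f => [|h gs IH] f /=; first by move=> ->; rewrite mulr0.
by move=> [a fa]; exists (c * a); rewrite -mulrA -mulrBr; exact: IH.
Qed.

Lemma in_ideal0 gs : in_ideal gs 0.
Proof. by elim: gs => [|h gs IH] //=; exists 0; rewrite mul0r subr0. Qed.

Lemma in_idealB gs f g : in_ideal gs f -> in_ideal gs g -> in_ideal gs (f - g).
Proof. by move=> fI gI; rewrite -[- g]mulN1r; apply: in_idealD => //; exact: in_idealM. Qed.

Lemma in_ideal_sum gs n (F : 'I_n -> A) :
  (forall i, in_ideal gs (F i)) -> in_ideal gs (\sum_i F i).
Proof. by move=> ?; elim/big_ind: _ => //; [exact: in_ideal0 | exact: in_idealD]. Qed.

Lemma in_ideal_swap gs a b f : in_ideal [:: a, b & gs] f -> in_ideal [:: b, a & gs] f.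
Proof. by move=> [c [d fI]]; exists d, c; rewrite addrAC. Qed.

Definition regular gs c := forall f, in_ideal gs (f * c) -> in_ideal gs f.

Lemma regular1 gs : regular gs 1.
Proof. by move=> f; rewrite mulr1. Qed.

Lemma regularN gs c : regular gs c -> regular gs (- c).
Proof. by move=> creg f /(in_idealM (-1)); rewrite mulrN mulN1r opprK => /creg. Qed.

Lemma regularM gs b c : regular gs b -> regular gs c -> regular gs (b * c).
Proof. by move=> breg creg f; rewrite mulrA => /creg/breg. Qed.

Lemma regularX gs c n : regular gs c -> regular gs (c ^+ n).
Proof.
move=> creg; elim: n => [|n IH]; first exact: regular1.
by rewrite exprS; exact: regularM.
Qed.

Lemma regular_swap gs a b c : regular [:: a, b & gs] c -> regular [:: b, a & gs] c.
Proof. by move=> creg f /in_ideal_swap/creg/in_ideal_swap. Qed.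

(** Permutation of a regular sequence: if f b = k a modulo gs, then k = l b because a is regular
    modulo b, and cancelling b gives f = l a. *)
Lemma regular_exchange gs a b :
  regular gs b -> regular (b :: gs) a -> regular (a :: gs) b.
Proof.
move=> breg areg f [k fbk].
have [|l kl] := areg k.
  exists f; rewrite -opprB -mulN1r; exact: in_idealM.
exists l; apply: breg.
rewrite (_ : _ * b = (f * b - k * a) + a * (k - l * b)); last by ring.
by apply: in_idealD => //; exact: in_idealM.
Qed.

End Ideals.

Lemma regular_nil (B : idomainType) (c : B) : c != 0 -> regular [::] c.
Proof. by move=> c0 f /= /eqP; rewrite mulf_eq0 (negPf c0) orbF => /eqP. Qed.

Lemma in_ideal_rmorph (A B : comNzRingType) (phi : {rmorphism A -> B}) gs f :
  in_ideal gs f -> in_ideal (map phi gs) (phi f).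
Proof.
elim: gs f => [|g gs IH] f /=; first by move=> ->; rewrite rmorph0.
by move=> [a /IH]; rewrite rmorphB rmorphM; exists (phi a).
Qed.

(** * Regularity read off from a leading coefficient *)

Section PolyIdeals.
Variable A : comNzRingType.
Implicit Types (a : A) (gs : seq A) (P Q : {poly A}).

Lemma in_ideal_polyC gs P :
  in_ideal (map polyC gs) P <-> forall i, in_ideal gs P`_i.
Proof.
split=> [|PI].
  elim: gs P => [|g gs IH] P /=; first by move=> -> i; rewrite coef0.
  by move=> [Q /IH PQ] i; exists Q`_i; rewrite -coefMC -coefB.
rewrite -[P]coefK poly_def; apply: in_ideal_sum => i.
rewrite -mul_polyC mulrC; apply: in_idealM.
exact: (in_ideal_rmorph polyC).
Qed.

(** If f P lies in the extended ideal, so does the leading coefficient of f times a; hence the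
    leading term of f is in the ideal, and subtracting it lowers the size of f. *)
Lemma regular_polyC gs P n Q :
  (size Q <= n)%N -> forall a, regular gs a ->
  P = a%:P * 'X^n + Q -> regular (map polyC gs) P.
Proof.
move=> szQ a areg -> f.
have [m] := ubnP (size f); elim: m f => // m IH f; rewrite ltnS => szf fP.
have [sz0|sz_gt0] := posnP (size f).
  by move/eqP: sz0; rewrite size_poly_eq0 => /eqP ->; exact: in_ideal0.
set k := (size f).-1.
have szk : size f = k.+1 by rewrite /k prednK.
have fk : in_ideal gs f`_k.
  apply: areg; move/in_ideal_polyC: fP => /(_ (n + k)%N).
  rewrite mulrDr coefD [X in _ + X]nth_default ?addr0; last first.
    rewrite (leq_trans (size_polyMleq _ _)) // szk addSn /= addnC.
    by rewrite leq_add2r.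
  by rewrite mulrA coefMXn addnC ltnNge leq_addl /= addnK coefMC.
set f' := f - (f`_k)%:P * 'X^k.
have fkP : in_ideal (map polyC gs) ((f`_k)%:P * 'X^k).
  by rewrite mulrC; apply: in_idealM; exact: (in_ideal_rmorph polyC).
rewrite -[f](subrK ((f`_k)%:P * 'X^k)); apply: in_idealD => //.
apply: IH => [|]; last first.
  by rewrite mulrBl; apply: in_idealB => //; rewrite mulrC; exact: in_idealM.
apply: leq_trans szf; rewrite szk ltnS; apply/leq_sizeP=> j.
rewrite coefB coefCM coefXn leq_eqVlt => /predU1P[<-|kj].
  by rewrite eqxx mulr1 subrr.
by rewrite gtn_eqF // mulr0 subr0 nth_default // szk.
Qed.

(* [ev] exhibits the elements of [A] as polynomials in [a0]; the hypothesis on *)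
(* the generators says that [a0] does not occur in them.                      *)
Lemma regular_ev (ev : {rmorphism A -> {poly A}}) (a0 : A) gs c n a Q :
  (forall f, (ev f).[a0] = f) -> (forall g, g \in gs -> ev g = g%:P) ->
  (size Q <= n)%N -> regular gs a -> ev c = a%:P * 'X^n + Q -> regular gs c.
Proof.
move=> evK evgs szQ areg evc f /(in_ideal_rmorph ev); rewrite rmorphM.
have -> : map ev gs = map polyC gs by apply/eq_in_map => g; exact: evgs.
move/(regular_polyC szQ areg evc)/in_ideal_polyC => fI.
rewrite -[f]evK horner_coef; apply: in_ideal_sum => i.
by rewrite mulrC; apply: in_idealM.
Qed.

End PolyIdeals.

Section MPoly.
Variables (K : comNzRingType) (n : nat).
Local Notation S := {mpoly K[n]}.

Lemma mpoly_rmorph_cong (B : comNzRingType) (f g : {rmorphism S -> B}) gs :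
  (forall a, f a%:MP = g a%:MP) ->
  (forall i, in_ideal gs (f 'X_i - g 'X_i)) ->
  forall p, in_ideal gs (f p - g p).
Proof.
move=> fgC fgX p; rewrite [p]mpolyE !rmorph_sum -sumrB.
elim/big_ind: _ => [||m _]; [exact: in_ideal0 | exact: in_idealD |].
rewrite -mul_mpolyC mpolyXE_id !rmorphM fgC -mulrBr; apply: in_idealM.
rewrite !rmorph_prod.
apply: (big_ind2 (fun a b => in_ideal gs (a - b))) => [|a b c d abI cdI|i _].
- by rewrite subrr; exact: in_ideal0.
- rewrite (_ : _ - _ = c * (a - b) + b * (c - d)); last by ring.
  by apply: in_idealD; exact: in_idealM.
elim: (m i) => [|k IH]; first by rewrite !expr0 !rmorph1 subrr; exact: in_ideal0.
rewrite exprS !rmorphM.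
set F := f 'X_i; set Fk := f ('X_i ^+ k); set H := g 'X_i; set Hk := g ('X_i ^+ k).
rewrite (_ : _ - _ = Fk * (F - H) + H * (Fk - Hk)); last by ring.
by apply: in_idealD; apply: in_idealM => //; exact: fgX.
Qed.

Lemma mpoly_rmorph_ext (B : comNzRingType) (f g : {rmorphism S -> B}) :
  (forall a, f a%:MP = g a%:MP) -> (forall i, f 'X_i = g 'X_i) -> f =1 g.
Proof.
move=> fgC fgX p; apply/subr0_eq/(@mpoly_rmorph_cong _ f g [::]) => // i.
by rewrite fgX subrr.
Qed.

Variable i : 'I_n.

(** Views S as polynomials in one chosen variable. The coefficients stay in S instead of a ring with
    one variable fewer, so no renumbering occurs; evaluation at that variable is a left inverse. *)
Definition polyvar : {rmorphism S -> {poly S}} :=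
  mmap (polyC \o @mpolyC n K) (fun j => if j == i then 'X else ('X_j)%:P).

Lemma polyvarX j : polyvar 'X_j = if j == i then 'X else ('X_j)%:P.
Proof. by rewrite /= mmapX mmap1U. Qed.

Lemma polyvarK f : (polyvar f).['X_i] = f.
Proof.
pose ev : {rmorphism S -> S} := horner_eval ('X_i : S) \o polyvar.
apply: (@mpoly_rmorph_ext _ ev idfun) => [a|j].
  by rewrite /ev /= mmapC /= /horner_eval hornerC.
rewrite /ev /= -[mmap _ _]/(polyvar : _ -> _) polyvarX /horner_eval.
by case: eqP => [->|_]; rewrite ?hornerX ?hornerC.
Qed.

End MPoly.

Definition cubic_relations (A : comNzRingType) (x : 'I_16 -> A) : seq {poly A} :=
  [:: (x (o 4))%:P - (x (o 0))%:P * 'X - (x (o 1))%:P * 'X^2;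
      (x (o 5))%:P - (x (o 2))%:P * 'X - (x (o 3))%:P * 'X^2;
      'X^3 + (x (o 6))%:P * 'X - (x (o 7))%:P].

(** * The presentation of S~_G as a quotient of S_G[w] *)

Section Kernel.
Variable R : realType.
Local Notation S := (SG R).
Local Notation St := (SGt R).
Local Notation X := (fun i : 'I_16 => 'X_i : S).
Local Notation w := (@xt R 5).

Lemma xtE k (k14 : (k < 14)%N) : @xt R k = 'X_(Ordinal k14).
Proof. by rewrite /xt; congr 'X_ _; apply: val_inj; rewrite /= inordK. Qed.

Lemma h_mapX i : h_map R 'X_i = tnth (hvals R) i.
Proof. by rewrite /= comp_mpolyXU -tnth_nth. Qed.

Lemma h_mapC a : h_map R a%:MP = a%:MP.
Proof. by rewrite /= comp_mpolyC. Qed.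

Definition h_ext : {rmorphism {poly S} -> St} :=
  horner_eval w \o map_poly (h_map R).

Lemma h_extC a : h_ext a%:P = h_map R a.
Proof. by rewrite /= map_polyC /horner_eval hornerC. Qed.

Lemma h_extX : h_ext 'X = w.
Proof. by rewrite /= map_polyX /horner_eval hornerX. Qed.

Definition h_lift : {rmorphism St -> {poly S}} :=
  mmap (polyC \o @mpolyC 16 _) (fun k : 'I_14 => tnth [tuple
    ('X_(o 0))%:P; ('X_(o 1))%:P; ('X_(o 2))%:P; ('X_(o 3))%:P; ('X_(o 6))%:P; 'X;
    ('X_(o 8))%:P; ('X_(o 9))%:P; ('X_(o 10))%:P; ('X_(o 11))%:P; ('X_(o 12))%:P;
    ('X_(o 13))%:P; ('X_(o 14))%:P; ('X_(o 15))%:P] k).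

Lemma h_liftX k : h_lift 'X_k = tnth [tuple
    ('X_(o 0))%:P; ('X_(o 1))%:P; ('X_(o 2))%:P; ('X_(o 3))%:P; ('X_(o 6))%:P; 'X;
    ('X_(o 8))%:P; ('X_(o 9))%:P; ('X_(o 10))%:P; ('X_(o 11))%:P; ('X_(o 12))%:P;
    ('X_(o 13))%:P; ('X_(o 14))%:P; ('X_(o 15))%:P] k.
Proof. by rewrite /= mmapX mmap1U. Qed.

Lemma h_liftC a : h_lift a%:MP = a%:MP%:P.
Proof. by rewrite /= mmapC. Qed.

Lemma h_liftK : cancel h_lift h_ext.
Proof.
apply: (@mpoly_rmorph_ext _ _ _ (h_ext \o h_lift) idfun) => [a|i].
  by rewrite [LHS](congr1 h_ext (h_liftC a)) h_extC h_mapC.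
rewrite [LHS](congr1 h_ext (h_liftX i)).
case: i => [[|[|[|[|[|[|[|[|[|[|[|[|[|[|//]]]]]]]]]]]]]] lti];
  rewrite (tnth_nth 0) [nth _ _ _]/= ?h_extC ?h_extX ?h_mapX ?(tnth_nth 0) /= xtE;
  by congr 'X_ _; apply: val_inj.
Qed.

Lemma h_lift_xt k : (k < 14)%N -> h_lift (xt R k) = nth 0 [::
    ('X_(o 0))%:P; ('X_(o 1))%:P; ('X_(o 2))%:P; ('X_(o 3))%:P; ('X_(o 6))%:P; 'X;
    ('X_(o 8))%:P; ('X_(o 9))%:P; ('X_(o 10))%:P; ('X_(o 11))%:P; ('X_(o 12))%:P;
    ('X_(o 13))%:P; ('X_(o 14))%:P; ('X_(o 15))%:P] k.
Proof. by move=> k14; rewrite xtE h_liftX (tnth_nth 0). Qed.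

(** Modulo the relations, [h_lift] after [h_ext] is the identity: only u, v and t_2 are changed,
    each by a multiple of one relation. *)
Lemma h_ext_kernel f : h_ext f = 0 -> in_ideal (cubic_relations X) f.
Proof.
pose E := cubic_relations X; pose c : {rmorphism S -> {poly S}} := polyC.
have E0 a b : a = b -> in_ideal E (a - b).
  by move=> ->; rewrite subrr; exact: in_ideal0.
have X_cong i : in_ideal E (c 'X_i - h_lift (h_map R 'X_i)).
  rewrite h_mapX (tnth_nth 0).
  case: i => [[|[|[|[|[|[|[|[|[|[|[|[|[|[|[|[|//]]]]]]]]]]]]]]]] lti];
    rewrite [nth _ _ _]/= ?(rmorphD h_lift, rmorphM h_lift, rmorphXn h_lift)
      !h_lift_xt // ![nth _ _ _]/= (bool_irrelevance lti isT).
  1-4,7,9-16: exact: E0.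
  - by exists 1, 0, 0; rewrite /c /=; ring.
  - by exists 0, 1, 0; rewrite /c /=; ring.
  - by exists 0, 0, (-1); rewrite /c /=; ring.
have C_cong a : in_ideal E (c a - h_lift (h_map R a)).
  apply: (@mpoly_rmorph_cong _ _ _ c (h_lift \o h_map R)) => // b.
  by rewrite [RHS](congr1 h_lift (h_mapC b)) h_liftC.
have E_cong g : in_ideal E (g - h_lift (h_ext g)).
  elim/poly_ind: g => [|g a IH]; first by rewrite !rmorph0 subrr; exact: in_ideal0.
  rewrite !rmorphD !rmorphM h_extX h_extC h_lift_xt // [nth _ _ _]/= opprD addrACA -mulrBl.
  by apply: in_idealD; [rewrite mulrC; exact: in_idealM | exact: C_cong].
by move=> hf; have := E_cong f; rewrite hf rmorph0 subr0.
Qed.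

End Kernel.

(** * The linear map l and the filtration by pole order *)

Section Extension.
Variables (A P : comNzRingType) (j : {rmorphism A -> P}).
Variables (x : 'I_16 -> A) (s : 'I_3 -> P).

Local Notation p1 := (x (o 0)).
Local Notation p2 := (x (o 1)).
Local Notation p3 := (x (o 2)).
Local Notation p4 := (x (o 3)).
Local Notation u := (x (o 4)).
Local Notation v := (x (o 5)).
Local Notation t1 := (x (o 6)).
Local Notation t2 := (x (o 7)).
Local Notation s1 := (s (o3 0)).
Local Notation s2 := (s (o3 1)).
Local Notation s3 := (s (o3 2)).

(** A window of three consecutive values l(w^n), advanced by w^3 = t_2 - t_1 w. *)
Fixpoint cubic_rec (a b c : P) (n : nat) : P :=
  if n is m.+1 then cubic_rec b c (j t2 * a - j t1 * b) m else a.

Definition cubic_seq : nat -> P := cubic_rec s1 s2 s3.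

Lemma cubic_seqS3 n : cubic_seq n.+3 = j t2 * cubic_seq n - j t1 * cubic_seq n.+1.
Proof. by rewrite /cubic_seq; elim: n s1 s2 s3 => // n IH a b c; exact: IH. Qed.

(** Matches the recurrence, in which the term of index n + 2 is absent. *)
Lemma cubic_ind (T : nat -> Prop) :
  T 0 -> T 1 -> T 2 -> (forall n, T n -> T n.+1 -> T n.+3) -> forall n, T n.
Proof.
move=> T0 T1 T2 T3 n; have [] : [/\ T n, T n.+1 & T n.+2] by
  elim: n => [|n [? ? ?]]; split=> //; exact: T3.
by [].
Qed.

Definition lin_ext (f : {poly A}) : P := \sum_(i < size f) j f`_i * cubic_seq i.

Lemma lin_extE n (f : {poly A}) : (size f <= n)%N -> lin_ext f = \sum_(i < n) j f`_i * cubic_seq i.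
Proof.
move=> szf; rewrite /lin_ext (big_ord_widen n (fun i => j f`_i * cubic_seq i)) //.
rewrite big_mkcond; apply: eq_bigr => i _; case: ltnP => // sz.
by rewrite nth_default // rmorph0 mul0r.
Qed.

Lemma lin_extD f g : lin_ext (f + g) = lin_ext f + lin_ext g.
Proof.
rewrite (lin_extE (size_polyD f g)) (lin_extE (leq_maxl _ (size g) : size f <= _)%N).
rewrite (lin_extE (leq_maxr (size f) _ : size g <= _)%N) -big_split.
by apply: eq_bigr => i _; rewrite coefD rmorphD mulrDl.
Qed.

Lemma lin_extZ a f : lin_ext (a *: f) = j a * lin_ext f.
Proof.
rewrite (lin_extE (size_scale_leq a f)) /lin_ext mulr_sumr.
by apply: eq_bigr => i _; rewrite coefZ rmorphM mulrA.
Qed.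

Lemma lin_ext0 : lin_ext 0 = 0.
Proof. by rewrite /lin_ext size_poly0 big_ord0. Qed.

Lemma lin_extXn n : lin_ext 'X^n = cubic_seq n.
Proof.
rewrite /lin_ext size_polyXn big_ord_recr /= coefXn eqxx rmorph1 mul1r big1 ?add0r //.
by move=> i _; rewrite coefXn ltn_eqF // rmorph0 mul0r.
Qed.

Lemma lin_extC a : lin_ext a%:P = j a * s1.
Proof. by rewrite -[a%:P]mulr1 mul_polyC lin_extZ -[1](expr0 'X) lin_extXn. Qed.

Lemma poly_monomial_ind (T : {poly A} -> Prop) :
  T 0 -> (forall f g, T f -> T g -> T (f + g)) ->
  (forall a n, T (a *: 'X^n)) -> forall f, T f.
Proof.
by move=> T0 TD TX f; rewrite -[f]coefK poly_def; elim/big_ind: _ => // i _; exact: TX.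
Qed.

Definition img y := exists a, y = j a.

Lemma imgD y z : img y -> img z -> img (y + z).
Proof. by move=> [a ->] [b ->]; exists (a + b); rewrite rmorphD. Qed.

Lemma imgM a y : img y -> img (j a * y).
Proof. by move=> [b ->]; exists (a * b); rewrite rmorphM. Qed.

Lemma imgB y z : img y -> img z -> img (y - z).
Proof. by move=> [a ->] [b ->]; exists (a - b); rewrite rmorphB. Qed.

Hypothesis Fs0 : forall g, g \in Fforms (j \o x) s -> g = 0.

Let Fz i : img (nth 0 (Fforms (j \o x) (fun=> 0)) i).
Proof.
have [i9|i9] := ltnP i 9; last by exists 0; rewrite nth_default // rmorph0.
exists (nth 0 (Fforms x (fun=> 0)) i).
rewrite -(nth_map 0 0) // rmorph_Fforms; congr (nth _ (Fforms _ _) _).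
by apply/funext => k /=; rewrite rmorph0.
Qed.

Let F0 i : nth 0 (Fforms (j \o x) s) i = 0.
Proof.
have [i9|i9] := ltnP i 9; last by rewrite nth_default.
by apply/Fs0/mem_nth.
Qed.

Let img_eq y z t : img z -> t = 0 -> t = y + z -> img y.
Proof.
move=> [a ->] -> /eqP; rewrite eq_sym addr_eq0 => /eqP ->.
by exists (- a); rewrite rmorphN.
Qed.

(** For n = 0, 1, 2 these are F1, F3, F5 without their constant terms; the recurrence gives the
    rest. The second column uses F2, F4, F6 likewise. *)
Lemma cubic_seq_col1 n : img (j u * cubic_seq n - j p1 * cubic_seq n.+1 - j p2 * cubic_seq n.+2).
Proof.
elim/cubic_ind: n => [|||n IH0 IH1].
- apply: (img_eq (Fz 0) (F0 0)); exact: F1_linear.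
- apply: (img_eq (Fz 2) (F0 2)); rewrite [LHS]F3_linear /cubic_seq /=; ring.
- apply: (img_eq (Fz 4) (F0 4)); rewrite [LHS]F5_linear /cubic_seq /=; ring.
rewrite !cubic_seqS3 (_ : _ - _ = j t2 * (j u * cubic_seq n - j p1 * cubic_seq n.+1 - j p2 * cubic_seq n.+2)
  - j t1 * (j u * cubic_seq n.+1 - j p1 * cubic_seq n.+2 - j p2 * cubic_seq n.+3)); last by rewrite !cubic_seqS3; ring.
by apply: imgB; exact: imgM.
Qed.

Lemma cubic_seq_col2 n : img (j v * cubic_seq n - j p3 * cubic_seq n.+1 - j p4 * cubic_seq n.+2).
Proof.
elim/cubic_ind: n => [|||n IH0 IH1].
- apply: (img_eq (Fz 1) (F0 1)); exact: F2_linear.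
- apply: (img_eq (Fz 3) (F0 3)); rewrite [LHS]F4_linear /cubic_seq /=; ring.
- apply: (img_eq (Fz 5) (F0 5)); rewrite [LHS]F6_linear /cubic_seq /=; ring.
rewrite !cubic_seqS3 (_ : _ - _ = j t2 * (j v * cubic_seq n - j p3 * cubic_seq n.+1 - j p4 * cubic_seq n.+2)
  - j t1 * (j v * cubic_seq n.+1 - j p3 * cubic_seq n.+2 - j p4 * cubic_seq n.+3)); last by rewrite !cubic_seqS3; ring.
by apply: imgB; exact: imgM.
Qed.

(** By linearity only w^n times a generator matters: the first two generators are the column lemmas,
    and the third is killed by the recurrence. *)
Lemma lin_ext_ideal f : in_ideal (cubic_relations x) f -> img (lin_ext f).
Proof.
have img0 : img 0 by exists 0; rewrite rmorph0.
have step e : (forall n, img (lin_ext ('X^n * e))) -> forall g, img (lin_ext (g * e)).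
  move=> He; elim/poly_monomial_ind => [|g h gI hI|a n].
  - by rewrite mul0r lin_ext0.
  - by rewrite mulrDl lin_extD; exact: imgD.
  - by rewrite -scalerAl lin_extZ; exact: imgM.
have e1 n : img (lin_ext ('X^n * ((u)%:P - (p1)%:P * 'X - (p2)%:P * 'X^2))).
  rewrite (_ : _ * _ = u *: 'X^n + (- p1) *: 'X^(n.+1) + (- p2) *: 'X^(n.+2)); last first.
    by rewrite -!mul_polyC !polyCN !exprS; ring.
  by rewrite !lin_extD !lin_extZ !lin_extXn !rmorphN !mulNr; exact: cubic_seq_col1.
have e2 n : img (lin_ext ('X^n * ((v)%:P - (p3)%:P * 'X - (p4)%:P * 'X^2))).
  rewrite (_ : _ * _ = v *: 'X^n + (- p3) *: 'X^(n.+1) + (- p4) *: 'X^(n.+2)); last first.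
    by rewrite -!mul_polyC !polyCN !exprS; ring.
  by rewrite !lin_extD !lin_extZ !lin_extXn !rmorphN !mulNr; exact: cubic_seq_col2.
have e3 n : img (lin_ext ('X^n * ('X^3 + (t1)%:P * 'X - (t2)%:P))).
  rewrite (_ : _ * _ = 'X^(n.+3) + t1 *: 'X^(n.+1) + (- t2) *: 'X^n); last first.
    by rewrite -!mul_polyC !polyCN !exprS; ring.
  rewrite !lin_extD !lin_extZ !lin_extXn cubic_seqS3 (_ : _ + _ = 0) // rmorphN; ring.
case=> a [b [c]] /= /eqP; rewrite subr_eq0 => /eqP fE.
rewrite -[f](subrK (a * (u%:P - p1%:P * 'X - p2%:P * 'X^2))) lin_extD.
apply: imgD; last exact: step.
rewrite -[X in lin_ext X](subrK (b * (v%:P - p3%:P * 'X - p4%:P * 'X^2))) lin_extD.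
by apply: imgD; rewrite ?fE; exact: step.
Qed.

(** Pole order at most n along D: l(f) counts as a simple pole, so s_1^m l(f) has order m + 1, and
    order 0 means coming from A. *)
Fixpoint pole_le n y : Prop :=
  if n is m.+1 then exists f z, pole_le m z /\ y = s1 ^+ m * lin_ext f + z else img y.

Lemma pole_leD n y z : pole_le n y -> pole_le n z -> pole_le n (y + z).
Proof.
elim: n y z => [|n IH] y z; first exact: imgD.
move=> [f [y' [y'n ->]]] [g [z' [z'n ->]]]; exists (f + g), (y' + z').
by split; [exact: IH | rewrite lin_extD; ring].
Qed.

Lemma pole_leM n a y : pole_le n y -> pole_le n (j a * y).
Proof.
elim: n y => [|n IH] y; first exact: imgM.
move=> [f [y' [y'n ->]]]; exists (a *: f), (j a * y').
by split; [exact: IH | rewrite lin_extZ; ring].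
Qed.

Lemma pole_leS n y : pole_le n y -> pole_le n.+1 y.
Proof. by move=> yn; exists 0, y; rewrite lin_ext0 mulr0 add0r. Qed.

Lemma pole_le_leq m n y : pole_le m y -> pole_le (m + n) y.
Proof. by move=> my; elim: n => [|n IH]; rewrite ?addn0 // addnS; exact: pole_leS. Qed.

Lemma pole_le_s1 n y : pole_le n y -> pole_le n.+1 (s1 * y).
Proof.
elim: n y => [|n IH] y.
  by move=> [a ->]; exists a%:P, 0; rewrite lin_extC /=; split; [exists 0; rewrite rmorph0 | ring].
by move=> [f [z [zn ->]]]; exists f, (s1 * z); split; [exact: IH | rewrite exprS; ring].
Qed.

Lemma pole_le_s1X m n y : pole_le n y -> pole_le (m + n) (s1 ^+ m * y).
Proof.
by elim: m => [|m IH] yn; rewrite ?mul1r // exprS -mulrA; exact/pole_le_s1/IH.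
Qed.

Lemma pole_le_lin_ext f : pole_le 1 (lin_ext f).
Proof. by exists f, 0; split; [exists 0; rewrite rmorph0 | rewrite mul1r addr0]. Qed.

Let pole_quad y a b c :
  img c -> y + j a * s1 - j b * s2 + c = 0 -> pole_le 1 y.
Proof.
move=> [d ->] y0; exists ((- a)%:P + b%:P * 'X), (j (- d)); split; first by exists (- d).
rewrite lin_extD lin_extC mul_polyC lin_extZ -['X]expr1 lin_extXn mul1r /cubic_seq /= !rmorphN.
by apply: subr0_eq; rewrite -y0; ring.
Qed.

Lemma pole_le_s2s2 : pole_le 1 (s1 * s3 - s2 * s2).
Proof.
apply: (@pole_quad _ (x (o 8) * p2 + x (o 9) * p4)
  (x (o 10) * p2 + x (o 11) * p4) _ (Fz 6)).
by rewrite -[RHS](F0 6) [RHS]F7_quadratic !(rmorphD, rmorphM).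
Qed.

Lemma pole_le_s2s3 : pole_le 1 (s2 * s3 - s1 * cubic_seq 3).
Proof.
apply: (@pole_quad _ (x (o 8) * p1 + x (o 9) * p3)
  (x (o 10) * p1 + x (o 11) * p3) _ (Fz 7)).
by rewrite -[RHS](F0 7) [RHS]F8_quadratic !(rmorphD, rmorphM).
Qed.

Lemma pole_le_s3s3 : pole_le 1 (s3 * s3 - s1 * cubic_seq 4).
Proof.
(* F9 carries an extra t_1 (s_1 s_3 - s_2^2), which F7 has already bounded. *)
rewrite -[X in pole_le 1 X](subrK (j t1 * (s1 * s3 - s2 * s2))).
apply: pole_leD; last exact/pole_leM/pole_le_s2s2.
apply: (@pole_quad _ (x (o 8) * u + x (o 9) * v)
  (x (o 10) * u + x (o 11) * v) _ (Fz 8)).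
by rewrite -[RHS](F0 8) [RHS]F9_quadratic !(rmorphD, rmorphM).
Qed.

Let pole_leN n y : pole_le n y -> pole_le n (- y).
Proof. by move=> /(pole_leM (-1)); rewrite rmorphN1 mulN1r. Qed.

(** For r = s_(k+1), multiplying l(f) by r agrees with s_1 l(w^k f) up to a simple pole. Three cases
    suffice by the recurrence and linearity. *)
Let pole_le_shift (r : P) k : (forall n, (n < 3)%N -> pole_le 1 (r * cubic_seq n - s1 * cubic_seq (n + k))) ->
  forall f, pole_le 1 (r * lin_ext f - s1 * lin_ext (f * 'X^k)).
Proof.
move=> H; have {}H n : pole_le 1 (r * cubic_seq n - s1 * cubic_seq (n + k)).
  elim/cubic_ind: n => [|||n IH0 IH1]; do 1?exact: H.
  rewrite !addSn !cubic_seqS3 -addSn (_ : _ - _ = j t2 * (r * cubic_seq n - s1 * cubic_seq (n + k))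
    + j (- t1) * (r * cubic_seq n.+1 - s1 * cubic_seq (n.+1 + k))); last by rewrite rmorphN; ring.
  by apply: pole_leD; exact: pole_leM.
elim/poly_monomial_ind => [|f g fP gP|a n].
- by rewrite mul0r lin_ext0 !mulr0 subr0; exists 0, 0; rewrite lin_ext0 mulr0 addr0; split=> //; exists 0; rewrite rmorph0.
- rewrite mulrDl !lin_extD !mulrDr opprD addrACA; exact: pole_leD.
- rewrite -scalerAl -exprD !lin_extZ !lin_extXn mulrCA [s1 * _]mulrCA -mulrBr; exact: pole_leM.
Qed.

(** The leading coefficient f becomes w^k f, and the error has lower order. Hence the filtration
    exhausts the algebra generated by A and the s_i. *)
Lemma pole_le_s i n y : pole_le n y -> pole_le n.+1 (s i * y).
Proof.
have main r k : (forall n, (n < 3)%N -> pole_le 1 (r * cubic_seq n - s1 * cubic_seq (n + k))) ->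
    (forall a, pole_le 1 (r * j a)) -> forall n y, pole_le n y -> pole_le n.+1 (r * y).
  move=> /pole_le_shift H H0; elim=> [|m IH] z; first by move=> [a ->].
  move=> [f [z' [/IH z'm ->]]].
  rewrite (_ : r * _ = s1 ^+ m.+1 * lin_ext (f * 'X^k)
    + (s1 ^+ m * (r * lin_ext f - s1 * lin_ext (f * 'X^k)) + r * z')); last by rewrite exprS; ring.
  exists (f * 'X^k), (s1 ^+ m * (r * lin_ext f - s1 * lin_ext (f * 'X^k)) + r * z').
  by split=> //; apply: pole_leD => //; rewrite -addn1; apply: pole_le_s1X.
have P0 : pole_le 1 0 by apply: pole_leS; exists 0; rewrite rmorph0.
case: i => [[|[|[|//]]] lti]; rewrite (bool_irrelevance lti isT).
- exact: pole_le_s1.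
- apply: (@main _ 1).
    case=> [|[|[|//]]] _; first by rewrite [_ * cubic_seq 0]mulrC subrr.
      by rewrite -opprB; exact/pole_leN/pole_le_s2s2.
    exact: pole_le_s2s3.
  by move=> a; rewrite mulrC -[s2]/(cubic_seq 1) -lin_extXn -lin_extZ; exact: pole_le_lin_ext.
- apply: (@main _ 2).
    case=> [|[|[|//]]] _; first by rewrite [_ * cubic_seq 0]mulrC subrr.
      by rewrite [s3 * _]mulrC; exact: pole_le_s2s3.
    exact: pole_le_s3s3.
  by move=> a; rewrite mulrC -[s3]/(cubic_seq 2) -lin_extXn -lin_extZ; exact: pole_le_lin_ext.
Qed.

End Extension.

(** * Restriction to D~ and its use for injectivity and for J_D^-1 *)

Section Residue.
Variables (A : comNzRingType) (B Q : idomainType).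
Variables (j : {rmorphism A -> Q}) (h : {rmorphism A -> B}) (w : B).
Variables (x : 'I_16 -> A) (s : 'I_3 -> Q).

Local Notation p1 := (x (o 0)).
Local Notation p2 := (x (o 1)).
Local Notation p3 := (x (o 2)).
Local Notation p4 := (x (o 3)).
Local Notation u := (x (o 4)).
Local Notation v := (x (o 5)).
Local Notation t1 := (x (o 6)).
Local Notation t2 := (x (o 7)).
Local Notation s1 := (s (o3 0)).
Local Notation s2 := (s (o3 1)).
Local Notation s3 := (s (o3 2)).
Local Notation sn := (cubic_seq j x s).
Local Notation ell := (lin_ext j x s).

Hypothesis jh : forall a, j a = 0 -> h a = 0.
Hypothesis Fs0 : forall g, g \in Fforms (j \o x) s -> g = 0.
Hypothesis hu : h u = w * h p1 + w ^+ 2 * h p2.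
Hypothesis hv : h v = w * h p3 + w ^+ 2 * h p4.
Hypothesis ht2 : h t2 = w ^+ 3 + h t1 * w.
Hypothesis hDelta : h (Delta x) != 0.
Hypothesis h_kernel : forall f : {poly A},
  (map_poly h f).[w] = 0 -> in_ideal (cubic_relations x) f.

Local Notation hext f := ((map_poly h f).[w]).

(** A relation rather than a function, as q need not come from A; b is unique by [residue_eq]. *)
Definition residue q b := exists a, q = j a /\ h a = b.

Lemma residue_eq q b c : residue q b -> residue q c -> b = c.
Proof.
move=> [a [-> <-]] [a' [aa' <-]]; apply: subr0_eq; rewrite -rmorphB.
by apply: jh; rewrite rmorphB aa' subrr.
Qed.

Lemma residueC a : residue (j a) (h a). Proof. by exists a. Qed.

Lemma residueD q r b c : residue q b -> residue r c -> residue (q + r) (b + c).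
Proof. by move=> [a [-> <-]] [d [-> <-]]; exists (a + d); rewrite !rmorphD. Qed.

Lemma residueN q b : residue q b -> residue (- q) (- b).
Proof. by move=> [a [-> <-]]; exists (- a); rewrite !rmorphN. Qed.

Lemma residueM q r b c : residue q b -> residue r c -> residue (q * r) (b * c).
Proof. by move=> [a [-> <-]] [d [-> <-]]; exists (a * d); rewrite !rmorphM. Qed.

Lemma residueX q b n : residue q b -> residue (q ^+ n) (b ^+ n).
Proof. by move=> [a [-> <-]]; exists (a ^+ n); rewrite !rmorphXn. Qed.

Lemma lin_ext_in_img f : hext f = 0 -> img j (ell f).
Proof. by move/h_kernel/lin_ext_ideal; exact. Qed.

Lemma img_cubic_seq g n : h g = 0 -> img j (j g * sn n).
Proof.
by move=> hg; rewrite -lin_extXn -lin_extZ; apply: lin_ext_in_img; rewrite map_polyZ hornerZ hg mul0r.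
Qed.

(** F1 and F2 express Delta s_2 and Delta s_3 through s_1 up to elements of A, whose products with g
    vanish on D~. There the coefficients of s_1 become w Delta and w^2 Delta, and Delta cancels. *)
Lemma residue_cubic_seq g b n : h g = 0 -> residue (j g * s1) b ->
  residue (j g * sn n) (w ^+ n * b).
Proof.
move=> hg gb.
have step m d e : j (Delta x) * sn m = j d * s1 - j e ->
    h d = h (Delta x) * w ^+ m -> residue (j g * sn m) (w ^+ m * b).
  move=> se hd; have [c gc] := img_cubic_seq m hg.
  rewrite gc (_ : w ^+ m * b = h c); first exact: residueC.
  apply: (mulfI hDelta); rewrite mulrA -hd.
  apply: (@residue_eq (j (Delta x) * (j g * sn m))); last first.
    by rewrite gc; apply: residueM; exact: residueC.
  rewrite (_ : _ * _ = j d * (j g * s1) - j e * j g); last first.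
    by rewrite mulrCA se; ring.
  rewrite (_ : h d * b = h d * b - h e * h g); last by rewrite hg mulr0 subr0.
  apply: residueD; first by apply: residueM => //; exact: residueC.
  by apply: residueN; apply: residueM; exact: residueC.
have [e1 e1E] := cubic_seq_col1 Fs0 0; have [e2 e2E] := cubic_seq_col2 Fs0 0.
elim/cubic_ind: n => [|||n IH0 IH1]; first by rewrite expr0 mul1r.
- apply: (step 1%N (p4 * u - p2 * v) (p4 * e1 - p2 * e2)).
    by rewrite /Delta !(rmorphB, rmorphM) -e1E -e2E /cubic_seq /=; ring.
  by rewrite /Delta !rmorphB !rmorphM hu hv; ring.
- apply: (step 2%N (p1 * v - p3 * u) (p1 * e2 - p3 * e1)).
    by rewrite /Delta !(rmorphB, rmorphM) -e1E -e2E /cubic_seq /=; ring.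
  by rewrite /Delta !rmorphB !rmorphM hu hv; ring.
rewrite cubic_seqS3 (_ : j g * _ = j t2 * (j g * sn n) - j t1 * (j g * sn n.+1)); last by ring.
rewrite (_ : _ * b = h t2 * (w ^+ n * b) - h t1 * (w ^+ n.+1 * b)); last first.
  by rewrite ht2 !exprS; ring.
by apply: residueD; [|apply: residueN]; apply: residueM => //; exact: residueC.
Qed.

Lemma residue_lin_ext g b f : h g = 0 -> residue (j g * s1) b ->
  residue (j g * ell f) (hext f * b).
Proof.
move=> hg gb; elim/poly_monomial_ind: f => [|f1 f2 IH1 IH2|a n].
- by rewrite lin_ext0 mulr0 map_poly0 horner0 mul0r -(rmorph0 j) -(rmorph0 h); exact: residueC.
- by rewrite lin_extD mulrDr rmorphD hornerD mulrDl; exact: residueD.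
- rewrite lin_extZ lin_extXn map_polyZ map_polyXn hornerZ hornerXn mulrCA -mulrA.
  by apply: residueM; [exact: residueC | exact: residue_cubic_seq].
Qed.

Section Injective.
Variables (P : comNzRingType) (i : {rmorphism A -> P}) (phi : {rmorphism P -> Q}).
Variable r : 'I_3 -> P.
Hypothesis phi_i : forall a, phi (i a) = j a.
Hypothesis phi_r : forall k, phi (r k) = s k.
Hypothesis Fr0 : forall g, g \in Fforms (i \o x) r -> g = 0.
Hypothesis j_kernel : forall a, j a = 0 -> i a = 0.
Variables (g0 : A) (b0 : B).
Hypothesis (hg0 : h g0 = 0) (b0_neq0 : b0 != 0).
Hypothesis g0s1 : residue (j g0 * s1) b0.

Lemma phi_cubic_seq n : phi (cubic_seq i x r n) = sn n.
Proof.
elim/cubic_ind: n => [|||n IH0 IH1]; rewrite ?[LHS]phi_r //.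
by rewrite !cubic_seqS3 rmorphB !rmorphM !phi_i IH0 IH1.
Qed.

Lemma phi_lin_ext f : phi (lin_ext i x r f) = ell f.
Proof. by rewrite rmorph_sum; apply: eq_bigr => k _; rewrite rmorphM phi_i phi_cubic_seq. Qed.

(** Since g0 vanishes on D, its n-th power clears a pole of order n. *)
Lemma residue_pole_le n y : pole_le i x r n y -> exists b, residue (j g0 ^+ n * phi y) b.
Proof.
elim: n y => [|n IH] y.
  by move=> [a ->]; exists (h a); rewrite mul1r phi_i; exact: residueC.
move=> [f [z [/IH[b zb] ->]]]; exists (b0 ^+ n * (hext f * b0) + h g0 * b).
rewrite rmorphD rmorphM rmorphXn phi_r phi_lin_ext.
rewrite (_ : _ * _ = (j g0 * s1) ^+ n * (j g0 * ell f) + j g0 * (j g0 ^+ n * phi z)); last first.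
  by rewrite exprMn exprS; ring.
apply: residueD; apply: residueM => //; [exact: residueX | exact: residue_lin_ext | exact: residueC].
Qed.

(* The coefficient of the highest power of [s1] is a residue along D, so it   *)
(* vanishes on D~ and the relations F1, ..., F6 absorb it.                    *)
Lemma pole_le_injective n y : pole_le i x r n y -> phi y = 0 -> y = 0.
Proof.
elim: n y => [|n IH] y; first by move=> [a ->]; rewrite phi_i; exact: j_kernel.
move=> [f [z [zn yE]]] y0; apply: IH => //; rewrite yE.
apply: pole_leD => //.
suff /h_kernel/(lin_ext_ideal Fr0) fi : hext f = 0.
  by have := @pole_le_s1X _ _ i x r n 0 _ fi; rewrite addn0.
have [b zb] := residue_pole_le zn.
have : b0 ^+ n * (hext f * b0) + h g0 * b = 0.
  apply: (@residue_eq (j g0 ^+ n.+1 * phi y)); last first.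
    by rewrite y0 mulr0 -(rmorph0 j) -(rmorph0 h); exact: residueC.
  rewrite yE rmorphD rmorphM rmorphXn phi_r phi_lin_ext.
  rewrite (_ : _ * _ = (j g0 * s1) ^+ n * (j g0 * ell f) + j g0 * (j g0 ^+ n * phi z)); last first.
    by rewrite exprMn exprS; ring.
  apply: residueD; apply: residueM => //; [exact: residueX | exact: residue_lin_ext | exact: residueC].
move/eqP; rewrite hg0 mul0r addr0 !mulf_eq0 expf_eq0 (negPf b0_neq0) andbF orbF.
by move/eqP.
Qed.

End Injective.

Section Inverse.
Variables (g1 g2 g3 c1 c2 : A).
Hypothesis h_g : [/\ h g1 = 0, h g2 = 0 & h g3 = 0].
Hypothesis g1s1 : j g1 * s1 = j c1.
Hypothesis g2s1 : j g2 * s1 = j c2.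
Hypothesis hc1 : h c1 != 0.
Hypothesis hc2 : regular [:: h c1] (h c2).
Hypothesis jg3 : j g3 != 0.
Hypothesis jc2 : forall a b, j a * j c2 = b * j g3 -> img j b -> exists k, j a = j k * j g3.
Hypothesis h_surj : forall b, exists f, hext f = b.

Lemma inverse_ideal q : (forall g, h g = 0 -> img j (q * j g)) ->
  exists f a, q = ell f + j a.
Proof.
move=> qI; have [hg1 hg2 hg3] := h_g.
have [a1 qg1] := qI _ hg1; have [a2 qg2] := qI _ hg2.
(* Both a1 c2 and a2 c1 equal q g1 g2 s_1. Restricting to D~, regularity of c2 modulo c1 shows that
   c1 divides a1 there; the quotient r is the polar part of q relative to s_1. *)
have [r a1E] : exists r, h a1 = r * h c1.
  have [|r rE] := hc2 (f := h a1).
    exists (h a2); apply/eqP; rewrite /= subr_eq0 -!rmorphM; apply/eqP.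
    apply: subr0_eq; rewrite -rmorphB; apply: jh; rewrite rmorphB !rmorphM -qg1 -qg2.
    by rewrite -g1s1 -g2s1; ring.
  by exists r; apply: subr0_eq.
have [f fr] := h_surj r; exists f.
(* After subtraction of l(f) the polar part is gone: all products with the ideal vanish on D~. *)
have {}qI g : h g = 0 -> exists2 a, (q - ell f) * j g = j a & h a = 0.
  move=> hg; have [a qg] := qI _ hg.
  have [b fb] : img j (ell f * j g).
    rewrite mulrC -lin_extZ; apply: lin_ext_in_img.
    by rewrite map_polyZ hornerZ hg mul0r.
  exists (a - b); first by rewrite mulrBl qg fb rmorphB.
  apply: (mulIf hc1); rewrite mul0r.
  have [c gc] := img_cubic_seq 0 hg.
  (* The same product grouped in two ways has residues h a h c1 and 0. *)
  apply: (@residue_eq ((q - ell f) * j g1 * (j g * s1))).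
    rewrite (_ : _ * _ = j (a - b) * (j g1 * s1)).
      by rewrite g1s1; apply: residueM; exact: residueC.
    by rewrite rmorphB -qg -fb; ring.
  rewrite gc -(mul0r (h c)); apply: residueM; last exact: residueC.
  rewrite mulrBl -[0](subrr (h a1)); apply: residueD; first by rewrite qg1; exact: residueC.
  apply: residueN; rewrite a1E -fr mulrC; apply: residue_lin_ext => //.
  by rewrite g1s1; exact: residueC.
have [a qg3 _] := qI _ hg3; have [b qg2' hb] := qI _ hg2.
(* As (q - l(f)) g2 vanishes on D~, multiplying it by s_1 still gives an element of A; so (q - l(f))
   c2 lies in A. Thus g3 divides a c2, hence a. *)
have [||k kE] := jc2 (a := a) (b := (q - ell f) * j c2).
- by rewrite -qg3; ring.
- rewrite -g2s1 mulrA qg2'; exact: (img_cubic_seq 0).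
exists k; apply/eqP; rewrite addrC -subr_eq; apply/eqP.
by apply: (mulIf jg3); rewrite qg3.
Qed.

End Inverse.
End Residue.

(** * Cramer's rule for the s_i *)

Section Cramer.
Variables (A : comNzRingType) (x : 'I_16 -> A).

Local Notation p1 := (x (o 0)).
Local Notation p2 := (x (o 1)).
Local Notation p3 := (x (o 2)).
Local Notation p4 := (x (o 3)).
Local Notation u := (x (o 4)).
Local Notation v := (x (o 5)).
Local Notation t1 := (x (o 6)).
Local Notation t2 := (x (o 7)).

Let z : 'I_3 -> A := fun=> 0.

(** The coefficients are the 2 x 2 minors, up to sign, of the last two rows of columns 1, 2, 3 of M.
    In [num135] the last column is column 5 minus t_1 times column 1, the linear part of F5, which
    leaves D_135 unchanged. *)
Definition num123 : A :=
  U1 x * F2 x z - (p1 * p3 + t1 * p2 * p4 + p4 * u) * F1 x z - Delta x * F3 x z.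

Definition num135 : A :=
  - ((u + t1 * p2) ^+ 2 + p1 * (t1 * p1 - t2 * p2)) * F1 x z
  - I1 x * F3 x z - U1 x * F5 x z.

Lemma Dminor123_s1 (s : 'I_3 -> A) : F1 x s = 0 -> F2 x s = 0 -> F3 x s = 0 ->
  Dminor x 1 2 3 * s (@Ordinal 3 0 isT) = num123.
Proof.
rewrite F1_linear F2_linear F3_linear /num123 -/z.
do 3![move/eqP; rewrite addrC addr_eq0 => /eqP ->].
by rewrite DminorE // /Mentry /= /U1 /Delta; ring.
Qed.

Lemma Dminor135_s1 (s : 'I_3 -> A) : F1 x s = 0 -> F3 x s = 0 -> F5 x s = 0 ->
  Dminor x 1 3 5 * s (@Ordinal 3 0 isT) = num135.
Proof.
rewrite F1_linear F3_linear F5_linear /num135 -/z.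
do 3![move/eqP; rewrite addrC addr_eq0 => /eqP ->].
by rewrite DminorE // /Mentry /= /U1 /I1; ring.
Qed.

End Cramer.

Lemma Fforms_solvable (Q : fieldType) (x : 'I_16 -> Q) :
  Gform x = 0 -> Delta x != 0 -> Dminor x 1 2 3 != 0 ->
  exists s, forall g, g \in Fforms x s -> g = 0.
Proof.
move=> G0 Delta0; set D := Dminor x 1 2 3 => D0; pose m := Mentry x; pose z : 'I_3 -> Q := fun=> 0.
pose b i := - nth 0 [:: F1 x z; F2 x z; F3 x z] i.
(* The determinant of columns 1, 2, 3 with one row replaced by the negated constant terms. *)
pose N := [::
  b 0%N * (m 1%N 1%N * m 2%N 2%N - m 1%N 2%N * m 2%N 1%N) - b 1%N * (m 1%N 0%N * m 2%N 2%N - m 1%N 2%N * m 2%N 0%N)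
    + b 2%N * (m 1%N 0%N * m 2%N 1%N - m 1%N 1%N * m 2%N 0%N);
  m 0%N 0%N * (b 1%N * m 2%N 2%N - b 2%N * m 2%N 1%N) - m 0%N 1%N * (b 0%N * m 2%N 2%N - b 2%N * m 2%N 0%N)
    + m 0%N 2%N * (b 0%N * m 2%N 1%N - b 1%N * m 2%N 0%N);
  m 0%N 0%N * (m 1%N 1%N * b 2%N - m 1%N 2%N * b 1%N) - m 0%N 1%N * (m 1%N 0%N * b 2%N - m 1%N 2%N * b 0%N)
    + m 0%N 2%N * (m 1%N 0%N * b 1%N - m 1%N 1%N * b 0%N)].
pose s (k : 'I_3) := N`_k / D; exists s.
have sD k : D * s k = N`_k by rewrite mulrC divfK.
have solve e a1 a2 a3 c : e = a1 * s (@Ordinal 3 0 isT)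
      + a2 * s (@Ordinal 3 1 isT) + a3 * s (@Ordinal 3 2 isT) + c ->
    a1 * N`_0 + a2 * N`_1 + a3 * N`_2 + c * D = 0 -> e = 0.
  move=> eE e0; apply: (mulfI D0); rewrite mulr0 -{}e0 eE.
  by rewrite -(sD (@Ordinal 3 0 isT)) -(sD (@Ordinal 3 1 isT)) -(sD (@Ordinal 3 2 isT)); ring.
have f1 : F1 x s = 0.
  apply: (@solve _ (x (o 4)) (- x (o 0)) (- x (o 1)) (F1 x z)).
    by rewrite F1_linear; ring.
  by rewrite /= /b /= /D DminorE // /m /Mentry /=; ring.
have f2 : F2 x s = 0.
  apply: (@solve _ (x (o 5)) (- x (o 2)) (- x (o 3)) (F2 x z)).
    by rewrite F2_linear; ring.
  by rewrite /= /b /= /D DminorE // /m /Mentry /=; ring.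
have f3 : F3 x s = 0.
  apply: (@solve _ _ _ (- x (o 0)) (F3 x z)); first by rewrite F3_linear -mulNr.
  by rewrite /= /b /= /D DminorE // /m /Mentry /=; ring.
have f4 : F4 x s = 0 by apply: (mulfI D0); rewrite plucker_syzygy G0 f1 f2 f3 !mulr0 subr0 !addr0.
have f5 : F5 x s = 0.
  by apply: (mulfI Delta0); rewrite Delta_F5 f1 f2 f3 f4 !mulr0 !subr0 addr0.
have f6 : F6 x s = 0.
  by apply: (mulfI Delta0); rewrite Delta_F6 f1 f2 f3 f4 !mulr0 !subr0 addr0.
have f7 : F7 x s = 0.
  by apply: (mulfI Delta0); rewrite Delta_F7 f1 f2 f3 f4 !mulr0 !subr0 addr0.
have f8 : F8 x s = 0.
  by apply: (mulfI Delta0); rewrite Delta_F8 f1 f2 f3 f4 !mulr0 !subr0 addr0.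
have f9 : F9 x s = 0.
  apply: (mulfI Delta0); have [a [b' [c [d ->]]]] := Delta_F9 x s.
  by rewrite f1 f2 f3 f4 !mulr0 !addr0.
move=> g; rewrite /Fforms f1 f2 f3 f4 f5 f6 f7 f8 f9 !inE.
by do !case/orP; move/eqP.
Qed.

Section Naturality.
Variables (A B : comNzRingType) (f : {rmorphism A -> B}) (x : 'I_16 -> A).

Lemma rmorph_Fforms0 k : (k < 9)%N ->
  f (nth 0 (Fforms x (fun=> 0)) k) = nth 0 (Fforms (f \o x) (fun=> 0)) k.
Proof.
move=> k9; rewrite -(nth_map 0 0) // rmorph_Fforms; congr (nth _ (Fforms _ _) _).
by apply/funext => i /=; rewrite rmorph0.
Qed.

Let fE := (rmorphB, rmorphD, rmorphN, rmorphM, rmorphXn).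

Lemma rmorph_U1 : f (U1 x) = U1 (f \o x).
Proof. by rewrite /U1 !fE. Qed.

Lemma rmorph_Delta : f (Delta x) = Delta (f \o x).
Proof. by rewrite /Delta !fE. Qed.

Lemma rmorph_num123 : f (num123 x) = num123 (f \o x).
Proof.
have := (rmorph_Fforms0 (isT : 0 < 9)%N, rmorph_Fforms0 (isT : 1 < 9)%N,
  rmorph_Fforms0 (isT : 2 < 9)%N).
rewrite /Fforms /= => E; rewrite /num123 -!E.
move: (F1 x _) (F2 x _) (F3 x _) => a b c.
by rewrite /U1 /Delta !fE.
Qed.

Lemma rmorph_num135 : f (num135 x) = num135 (f \o x).
Proof.
have := (rmorph_Fforms0 (isT : 0 < 9)%N, rmorph_Fforms0 (isT : 2 < 9)%N,
  rmorph_Fforms0 (isT : 4 < 9)%N).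
rewrite /Fforms /= => E; rewrite /num135 -!E.
move: (F1 x _) (F3 x _) (F5 x _) => a b c.
by rewrite /U1 /I1 !fE.
Qed.

End Naturality.

(** * Dependence of the Cramer numerators on single L variables *)

Section Linear.
Variables (A : comNzRingType) (x y : 'I_16 -> A).

Ltac expand := rewrite /num123 /num135 /F1 /F2 /F3 /F5 /lam /mu /Delta /U1 /U2 /U3
  /I1 /I2 /I3 /W1 /W2 /W3.

Lemma num135_L123 : (forall i, i != o 8 -> x i = y i) -> y (o 8) = 0 ->
  num135 x = - U1 y ^+ 2 * x (o 8) + num135 y.
Proof. by move=> xy y0; expand; rewrite y0 -!xy //; ring. Qed.

Lemma num123_L124 : (forall i, i != o 9 -> x i = y i) -> y (o 9) = 0 ->
  num123 x = Delta y ^+ 2 * x (o 9) + num123 y.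
Proof. by move=> xy y0; expand; rewrite y0 -!xy //; ring. Qed.

Lemma num135_L135 : (forall i, i != o 12 -> x i = y i) -> num135 x = num135 y.
Proof. by move=> xy; expand; rewrite !xy. Qed.

Lemma num123_L123 : (forall i, i != o 8 -> x i = y i) -> num123 x = num123 y.
Proof. by move=> xy; expand; rewrite !xy. Qed.

End Linear.

Lemma regular_polyvar (K : comNzRingType) n (i : 'I_n) (gs : seq {mpoly K[n]}) c m a Q :
  (forall g, g \in gs -> polyvar K i g = g%:P) -> regular gs a ->
  polyvar K i c = a%:P * 'X^m + Q -> (size Q <= m)%N -> regular gs c.
Proof.
by move=> gsE areg cE szQ; exact: (regular_ev (@polyvarK K n i) gsE szQ areg cE).
Qed.

Lemma size_quadratic (A : comNzRingType) (a b c : A) :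
  (size (a%:P * 'X^2 + b%:P * 'X + c%:P)%R <= 3)%N.
Proof.
rewrite (_ : _ + _ = \poly_(i < 3) [:: c; b; a]`_i); first exact: size_poly.
by apply/polyP=> -[|[|[|i]]]; rewrite !coefE /= ?(mulr0, mulr1, addr0, add0r).
Qed.

Lemma size_linear (A : comNzRingType) (b c : A) : (size (b%:P * 'X + c%:P)%R <= 2)%N.
Proof.
rewrite (_ : _ + _ = \poly_(i < 2) [:: c; b]`_i); first exact: size_poly.
by apply/polyP=> -[|[|i]]; rewrite !coefE /= ?(mulr0, mulr1, addr0, add0r).
Qed.

Lemma size_const (A : comNzRingType) (c : A) : (size (c%:P)%R <= 1)%N.
Proof. by rewrite size_polyC leq_b1. Qed.

(** * The regular sequence in S_G *)

Section RegularS.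
Variable K : idomainType.
Local Notation S := {mpoly K[16]}.
Local Notation X := (fun i : 'I_16 => 'X_i : S).
Local Notation p1 := (X (o 0)).
Local Notation p2 := (X (o 1)).
Local Notation p3 := (X (o 2)).
Local Notation p4 := (X (o 3)).
Local Notation u := (X (o 4)).
Local Notation v := (X (o 5)).
Local Notation t1 := (X (o 6)).
Local Notation t2 := (X (o 7)).
Local Notation D135 := (Dminor X 1 3 5).
Local Notation D246 := (Dminor X 2 4 6).

Let Y (k i : 'I_16) : {poly S} := if i == k then 'X else ('X_i)%:P.

Let polyvarY k : polyvar K k \o X = Y k.
Proof. by apply/funext => i; exact: polyvarX. Qed.

Let D135_v : polyvar K (o 5) D135 = D135%:P.
Proof.
rewrite (rmorph_Dminor (polyvar K (o 5))) polyvarY (rmorph_Dminor polyC).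
by rewrite !Dminor135.
Qed.

Let U1_v : polyvar K (o 5) (U1 X) = (U1 X)%:P.
Proof. by rewrite (rmorph_U1 (polyvar K (o 5))) polyvarY (rmorph_U1 polyC). Qed.

Let U1_t2 : polyvar K (o 7) (U1 X) = (U1 X)%:P.
Proof. by rewrite (rmorph_U1 (polyvar K (o 7))) polyvarY (rmorph_U1 polyC). Qed.

Let Dminor_L (k : 'I_16) a b c : (8 <= k)%N -> polyvar K k (Dminor X a b c) = (Dminor X a b c)%:P.
Proof.
move=> k8; rewrite (rmorph_Dminor (polyvar K k)) polyvarY (rmorph_Dminor polyC).
by apply: eq_Dminor => l l8; rewrite /Y -val_eqE /= ltn_eqF // (leq_trans l8).
Qed.

Let U1_neq0 : U1 X != 0.
Proof.
apply: contra_neq (oner_neq0 K) => /(congr1 (meval (fun i => (i == o 0)%:R))).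
rewrite rmorph0 (rmorph_U1 (meval _)) => <-.
by rewrite /U1 /= !mevalXU /=; ring.
Qed.

Let D135_neq0 : D135 != 0.
Proof.
apply: contra_neq (oner_neq0 K) => /(congr1 (meval (fun i => (i == o 4)%:R))).
rewrite rmorph0 (rmorph_Dminor (meval _)) => <-.
by rewrite Dminor135 /= !mevalXU /=; ring.
Qed.

Let X_neq0 n (i : 'I_n) : ('X_i : {mpoly K[n]}) != 0.
Proof.
apply: contra_neq (oner_neq0 K) => /(congr1 (meval (fun=> 1))).
by rewrite rmorph0 /= mevalXU.
Qed.

Let regular_U1_p2 : regular [:: p2] (U1 X).
Proof.
apply: (@regular_polyvar _ _ (o 0) _ _ 2 1 (t1 * p2 ^+ 2 + p2 * u)%:P); last first.
- by rewrite (leq_trans (size_const _)).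
- by rewrite (rmorph_U1 (polyvar K _)) polyvarY /U1 /Y /=; ring.
- exact: regular1.
- by move=> g; rewrite inE => /eqP ->; rewrite polyvarX.
Qed.

(** As a polynomial in t_2, D_135 has leading coefficient - p_2^3, and t_2 does not occur in U_1. *)
Let regular_D135_U1 : regular [:: U1 X] D135.
Proof.
apply: (@regular_polyvar _ _ (o 7) _ _ 2 (- p2 ^+ 3) ((- (3 * p1 * p2 * u + p1 ^+ 3 + t1 * p1 * p2 ^+ 2))%:P * 'X
 + (u ^+ 3 + t1 * p2 * u ^+ 2 + t1 * u * p1 ^+ 2 + t1 * p2 * u * (u + t1 * p2))%:P)); last first.
- exact: size_linear.
- by rewrite (rmorph_Dminor (polyvar K _)) polyvarY Dminor135 /Y /=; ring.
- apply/regularN/regularX/regular_exchange; last exact: regular_U1_p2.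
  exact/regular_nil/X_neq0.
- by move=> g; rewrite inE => /eqP ->.
Qed.

(** D_246 is a monic cubic in v. *)
Let regular_D246 gs : (forall g, g \in gs -> polyvar K (o 5) g = g%:P) -> regular gs D246.
Proof.
move=> gsE; apply: (@regular_polyvar _ _ (o 5) _ _ 3 1
  ((2 * t1 * p4)%:P * 'X^2 + (- 3 * t2 * p3 * p4 + t1 * p3 ^+ 2 + t1 ^+ 2 * p4 ^+ 2)%:P * 'X
   + (- (t2 * p3 ^+ 3 + p4 ^+ 3 * t2 ^+ 2 + t1 * t2 * p3 * p4 ^+ 2))%:P)) => //; last first.
- exact: size_quadratic.
- by rewrite (rmorph_Dminor (polyvar K _)) polyvarY Dminor246 /Y /=; ring.
- exact: regular1.
Qed.

Let X0 (k i : 'I_16) : S := if i == k then 0 else 'X_i.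

Let Y_X0 k i : i != k -> Y k i = (polyC \o X0 k) i.
Proof. by rewrite /Y /X0 /= => /negPf ->. Qed.

Let X0k k : (polyC \o X0 k) k = 0.
Proof. by rewrite /X0 /= eqxx polyC0. Qed.

Let U1_X0 : U1 (X0 (o 8)) = U1 X. Proof. by []. Qed.

Let regular_num135 gs : (forall g, g \in gs -> polyvar K (o 8) g = g%:P) ->
  regular gs (U1 X) -> regular gs (num135 X).
Proof.
move=> gsE U1reg; apply: (@regular_polyvar _ _ (o 8) _ _ 1 (- U1 X ^+ 2) (num135 (X0 (o 8)))%:P) => //.
- exact/regularN/regularX.
- rewrite (rmorph_num135 (polyvar K _)) polyvarY (num135_L123 (@Y_X0 _) (X0k _)).
  rewrite -(rmorph_num135 polyC) -(rmorph_U1 polyC) U1_X0 {1}/Y /= expr1.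
  by rewrite polyCN polyC_exp.
- exact: size_const.
Qed.

(** By exchange it suffices that G is regular modulo [num135] and D_246, where L_135 does not occur.
    G is linear in L_135 with coefficient D_135. Another exchange reduces to [num135] modulo D_135
    and D_246, linear in L_123 with coefficient - U_1^2, and finally to U_1 modulo D_135 and
    D_246. *)
Lemma regular_G : regular [:: Gform X; D246] (num135 X).
Proof.
have D246_v g : g \in [:: D246] -> polyvar K (o 8) g = g%:P.
  by rewrite inE => /eqP ->; exact: Dminor_L.
have num135_D246 : regular [:: D246] (num135 X).
  apply: regular_num135 => //; apply: regular_exchange; first exact: regular_nil.
  by apply: regular_D246 => g; rewrite inE => /eqP ->.
apply: regular_exchange => //.
apply: (@regular_polyvar _ _ (o 12) _ _ 1 D135 (Gform (X0 (o 12)))%:P).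
- move=> g; rewrite !inE => /orP[]/eqP ->; last exact: Dminor_L.
  rewrite (rmorph_num135 (polyvar K _)) polyvarY (num135_L135 (@Y_X0 _)).
  by rewrite -(rmorph_num135 polyC) (num135_L135 (y := X)) // => i; rewrite /X0 => /negPf ->.
- apply: regular_exchange.
    apply: regular_exchange; first exact: regular_nil.
    by apply: regular_D246 => g; rewrite inE => /eqP ->.
  apply: regular_num135 => [g|].
    by rewrite !inE => /orP[]/eqP ->; exact: Dminor_L.
  apply/regular_swap/regular_exchange.
    by apply: regular_exchange; [exact: regular_nil | exact: regular_D135_U1].
  by apply: regular_D246 => g; rewrite !inE => /orP[]/eqP ->.
- rewrite (rmorph_Gform (polyvar K _)) polyvarY (GPrime.Gform_L135 (@Y_X0 _) (X0k _)).
  by rewrite -(rmorph_Gform polyC) -polyvarY -(rmorph_Dminor (polyvar K _)) Dminor_L // [_ (o 12)]polyvarX expr1.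
- exact: size_const.
Qed.

End RegularS.

(** * The regular sequence on D~ *)

(** The parametrisation behind h with values in any ring, so that it commutes with [polyvar] and
    with evaluation. *)
Definition normal_point (A : comNzRingType) (y : 'I_14 -> A) (i : 'I_16) : A :=
  let p1 := y (o14 0) in let p2 := y (o14 1) in let p3 := y (o14 2) in
  let p4 := y (o14 3) in let t1 := y (o14 4) in let w := y (o14 5) in
  nth 0 [:: p1; p2; p3; p4; w * p1 + w ^+ 2 * p2; w * p3 + w ^+ 2 * p4; t1;
    w ^+ 3 + t1 * w; y (o14 6); y (o14 7); y (o14 8); y (o14 9); y (o14 10);
    y (o14 11); y (o14 12); y (o14 13)] i.

Lemma rmorph_normal_point (A B : comNzRingType) (f : {rmorphism A -> B}) y :
  f \o normal_point y = normal_point (f \o y).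
Proof.
apply/funext => -[[|[|[|[|[|[|[|[|[|[|[|[|[|[|[|[|//]]]]]]]]]]]]]]]] lti] /=;
  by rewrite /normal_point /= ?(rmorphD, rmorphM, rmorphXn).
Qed.

Section RegularSt.
Variable K : idomainType.
Local Notation S := {mpoly K[14]}.
Local Notation Z := (normal_point (fun i : 'I_14 => 'X_i : S)).
Local Notation p1 := ('X_(o14 0) : S).
Local Notation p2 := ('X_(o14 1) : S).

Let Y (k i : 'I_14) : {poly S} := if i == k then 'X else ('X_i)%:P.

Let polyvarY k : polyvar K k \o Z = normal_point (Y k).
Proof.
rewrite rmorph_normal_point; congr normal_point.
by apply/funext => i; exact: polyvarX.
Qed.

Let X_neq0 (i : 'I_14) : ('X_i : S) != 0.
Proof.
apply: contra_neq (oner_neq0 K) => /(congr1 (meval (fun=> 1))).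
by rewrite rmorph0 /= mevalXU.
Qed.

Let U1_neq0 : U1 Z != 0.
Proof.
apply: contra_neq (oner_neq0 K) => /(congr1 (meval (fun i => (i == o14 0)%:R))).
rewrite rmorph0 (rmorph_U1 (meval _)) rmorph_normal_point => <-.
by rewrite /U1 /normal_point /= !mevalXU /=; ring.
Qed.

Let U1_polyvar (k : 'I_14) : (5 < k)%N -> polyvar K k (U1 Z) = (U1 Z)%:P.
Proof.
move=> k5; rewrite (rmorph_U1 (polyvar K k)) polyvarY (rmorph_U1 polyC) rmorph_normal_point.
have Yk (i : 'I_14) : (i <= 5)%N -> Y k i = ('X_i)%:P.
  by move=> i5; rewrite /Y -val_eqE ltn_eqF // (leq_ltn_trans i5).
by rewrite /U1 /normal_point /= !Yk.
Qed.

Let Delta_polyvar (k : 'I_14) : (5 < k)%N -> polyvar K k (Delta Z) = (Delta Z)%:P.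
Proof.
move=> k5; rewrite (rmorph_Delta (polyvar K k)) polyvarY (rmorph_Delta polyC) rmorph_normal_point.
have Yk (i : 'I_14) : (i <= 5)%N -> Y k i = ('X_i)%:P.
  by move=> i5; rewrite /Y -val_eqE ltn_eqF // (leq_ltn_trans i5).
by rewrite /Delta /normal_point /= !Yk.
Qed.

Let regular_p2 : regular [:: p1] p2.
Proof.
apply: (@regular_polyvar _ _ (o14 1) _ _ 1 1 0) => [g|||].
- by rewrite inE => /eqP ->; rewrite polyvarX.
- exact: regular1.
- by rewrite polyvarX /= mul1r addr0 expr1.
- by rewrite size_poly0.
Qed.

Let regular_U1 : regular [:: p1] (U1 Z).
Proof.
apply: (@regular_polyvar _ _ (o14 4) _ _ 1 (p2 ^+ 2)
  (p1 ^+ 2 + p2 * ('X_(o14 5) * p1 + 'X_(o14 5) ^+ 2 * p2))%:P) => [g|||].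
- by rewrite inE => /eqP ->; rewrite polyvarX.
- exact: regularX.
- by rewrite (rmorph_U1 (polyvar K _)) polyvarY /U1 /normal_point /Y /=; ring.
- exact: size_const.
Qed.

Let regular_Delta : regular [:: U1 Z] (Delta Z).
Proof.
apply: (@regular_polyvar _ _ (o14 3) _ _ 1 p1 (- p2 * 'X_(o14 2))%:P) => [g|||].
- rewrite inE => /eqP ->; rewrite (rmorph_U1 (polyvar K _)) polyvarY (rmorph_U1 polyC).
  by rewrite rmorph_normal_point.
- by apply: regular_exchange regular_U1; exact: regular_nil.
- by rewrite (rmorph_Delta (polyvar K _)) polyvarY /Delta /normal_point /Y /=; ring.
- exact: size_const.
Qed.

Let Y0 (k i : 'I_14) : S := if i == k then 0 else 'X_i.

(** The L variables are numbered from 6 in S~_G and from 8 in S_G. *)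
Let Z_eq (k : 'I_14) (l : 'I_16) : (5 < k)%N -> l = k.+2 :> nat ->
  forall i, i != l -> normal_point (Y k) i = (polyC \o normal_point (Y0 k)) i.
Proof.
move=> k5 lk i il; rewrite rmorph_normal_point /normal_point /=.
have Yk (m : 'I_14) : m != k -> Y k m = (Y0 k m)%:P by rewrite /Y /Y0 => /negPf ->.
have Ym (m : 'I_14) : (m <= 5)%N -> Y k m = (Y0 k m)%:P.
  by move=> m5; apply: Yk; rewrite -val_eqE ltn_eqF // (leq_ltn_trans m5).
rewrite (Ym (o14 0)) // (Ym (o14 1)) // (Ym (o14 2)) // (Ym (o14 3)) // (Ym (o14 4)) // (Ym (o14 5)) //.
case: i il => [[|[|[|[|[|[|[|[|[|[|[|[|[|[|[|[|//]]]]]]]]]]]]]]]] lti] //=;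
  by rewrite -val_eqE /= lk !eqSS => il; apply: Yk; rewrite -val_eqE.
Qed.

Let Y0_8 : (polyC \o normal_point (Y0 (o14 6))) (o 8) = 0.
Proof. by rewrite /normal_point /Y0 /= polyC0. Qed.

Let Y0_9 : (polyC \o normal_point (Y0 (o14 7))) (o 9) = 0.
Proof. by rewrite /normal_point /Y0 /= polyC0. Qed.

Let regular_num123 : regular [:: U1 Z] (num123 Z).
Proof.
apply: (@regular_polyvar _ _ (o14 7) _ _ 1 (Delta Z ^+ 2)
  (num123 (normal_point (Y0 (o14 7))))%:P) => [g|||].
- by rewrite inE => /eqP ->; exact: U1_polyvar.
- exact: regularX.
- rewrite (rmorph_num123 (polyvar K _)) polyvarY.
  rewrite (num123_L124 (@Z_eq (o14 7) (o 9) isT erefl) Y0_9).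
  rewrite -(rmorph_num123 polyC) -(rmorph_Delta polyC) expr1 polyC_exp.
  by congr (_ ^+ 2 * _ + _).
- exact: size_const.
Qed.

(** Linearity in L_123 with coefficient - U_1^2 reduces this to U_1 modulo [num123]. By exchange and
    linearity of [num123] in L_124 with coefficient Delta^2, it remains to treat Delta modulo U_1,
    which is linear in p_4 with coefficient p_1. *)
Lemma regular_residues : regular [:: num123 Z] (num135 Z).
Proof.
apply: (@regular_polyvar _ _ (o14 6) _ _ 1 (- U1 Z ^+ 2)
  (num135 (normal_point (Y0 (o14 6))))%:P) => [g|||].
- rewrite inE => /eqP ->; rewrite (rmorph_num123 (polyvar K _)) polyvarY (rmorph_num123 polyC).
  rewrite (num123_L123 (@Z_eq (o14 6) (o 8) isT erefl)).
  apply: num123_L123 => i i8; congr polyC.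
  by case: i i8 => [[|[|[|[|[|[|[|[|[|[|[|[|[|[|[|[|//]]]]]]]]]]]]]]]] lti].
- by apply/regularN/regularX/regular_exchange => //; exact: regular_nil.
- rewrite (rmorph_num135 (polyvar K _)) polyvarY.
  rewrite (num135_L123 (@Z_eq (o14 6) (o 8) isT erefl) Y0_8).
  rewrite -(rmorph_num135 polyC) -(rmorph_U1 polyC) expr1 polyCN polyC_exp.
  by congr (- _ ^+ 2 * _ + _).
- exact: size_const.
Qed.

Lemma Delta_neq0 : Delta Z != 0.
Proof.
apply: contra_neq (oner_neq0 K) => /(congr1 (meval (fun i => ((i == o14 0) || (i == o14 3))%:R))).
rewrite rmorph0 (rmorph_Delta (meval _)) rmorph_normal_point => <-.
by rewrite /Delta /normal_point /= !mevalXU /=; ring.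
Qed.

Lemma num123_neq0 : num123 Z != 0.
Proof.
(* At p_1 = p_4 = L_124 = 1 and all else 0, only Delta^2 L_124 = 1 survives. *)
apply: contra_neq (oner_neq0 K) => /(congr1 (meval (fun i =>
  ((i == o14 0) || (i == o14 3) || (i == o14 7))%:R))).
rewrite rmorph0 (rmorph_num123 (meval _)) rmorph_normal_point => <-.
rewrite /num123 /F1 /F2 /F3 /lam /mu /Delta /U1 /U2 /U3 /I1 /I2 /I3 /normal_point /= !mevalXU /=.
by ring.
Qed.

End RegularSt.

Lemma Gform_eq0 (A : comNzRingType) (e : 'I_16 -> A) :
  (forall i : 'I_16, (8 <= i)%N -> e i = 0) -> Gform e = 0.
Proof.
move=> e0; rewrite /Gform (e0 (o 8) isT) (e0 (o 9) isT) (e0 (o 10) isT) (e0 (o 11) isT)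
  (e0 (o 12) isT) (e0 (o 13) isT) (e0 (o 14) isT) (e0 (o 15) isT).
by rewrite !mul0r !addr0.
Qed.

Lemma Fforms_Gform (A : comNzRingType) (x : 'I_16 -> A) (s : 'I_3 -> A) :
  (forall g, g \in Fforms x s -> g = 0) -> Gform x = 0.
Proof.
move=> F0; have {}F0 k : nth 0 (Fforms x s) k = 0.
  have [k9|k9] := ltnP k 9; last by rewrite nth_default.
  by apply/F0/mem_nth.
rewrite (Gform_syzygy _ s).
move: (F0 0%N) (F0 1%N) (F0 2%N) (F0 3%N) (F0 4%N) (F0 5%N); rewrite /Fforms /=.
by move=> -> -> -> -> -> ->; ring.
Qed.

Lemma ideal_quot_lift (A B : comNzRingType) (I : idealr A) (f : {rmorphism A -> B}) :
  (forall a, a \in I -> f a = 0) ->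
  exists phi : {rmorphism {ideal_quot I} -> B}, forall a, phi (\pi_{ideal_quot I}%qT a) = f a.
Proof.
move=> fI; pose Q := {ideal_quot I}; pose phi (y : Q) := f (repr y).
have phi_pi a : phi (\pi_Q%qT a) = f a.
  apply/subr0_eq; rewrite -rmorphB; apply: fI.
  by rewrite (Quotient.idealrBE I) reprK.
have phiB : zmod_morphism phi.
  move=> y z; rewrite -[y]reprK -[z]reprK -(rmorphB (\pi_Q%qT)) !phi_pi.
  exact: rmorphB.
have phiM : monoid_morphism phi.
  split=> [|y z]; first by rewrite -(rmorph1 (\pi_Q%qT)) phi_pi rmorph1.
  rewrite -[y]reprK -[z]reprK -(rmorphM (\pi_Q%qT)) !phi_pi.
  exact: rmorphM.
pose m1 := GRing.isZmodMorphism.Build _ _ phi phiB.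
pose m2 := GRing.isMonoidMorphism.Build _ _ phi phiM.
pose phi' : {rmorphism Q -> B} := HB.pack phi m1 m2.
by exists phi'.
Qed.

Lemma mpoly_generated (A P : comNzRingType) n (f : {rmorphism {mpoly A[n]} -> P})
    (T : P -> Prop) :
  (forall a, T (f a%:MP)) -> (forall y z, T y -> T z -> T (y + z)) ->
  (forall i y, T y -> T (f 'X_i * y)) -> forall p, T (f p).
Proof.
move=> TC TD TX p; rewrite [p]mpolyE rmorph_sum.
elim/big_ind: _ => [||m _] //; first by rewrite -(rmorph0 f) -mpolyC0; exact: TC.
rewrite -mul_mpolyC mulrC mpolyXE_id; move: p@_m => c.
elim: (index_enum _) => [|i r IH]; first by rewrite big_nil mul1r.
rewrite big_cons; elim: (m i) => [|k IHk]; first by rewrite mul1r.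
by rewrite exprS -!mulrA rmorphM; apply: TX; rewrite mulrA.
Qed.

Lemma mmap_Fforms (A Q : comNzRingType) (j : {rmorphism A -> Q}) (x : 'I_16 -> A)
    (s : 'I_3 -> Q) :
  (forall g, g \in Fforms (j \o x) s -> g = 0) ->
  forall f : {mpoly A[3]}, f \in ideal_gen (Fforms (fun i => (x i)%:MP) (fun k => 'X_k)) ->
  mmap j s f = 0.
Proof.
move=> F0 f /asboolP[a ->]; rewrite rmorph_sum big1 // => i _.
rewrite rmorphM /=; set g := (X in _ * mmap j s X).
have /(map_f (mmap j s)) : g \in Fforms (fun i => (x i)%:MP) (fun k => 'X_k).
  exact: mem_nth.
rewrite (rmorph_Fforms (mmap j s)) (_ : _ \o _ = j \o x); last first.
  by apply/funext => k /=; rewrite mmapC.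
rewrite (_ : _ \o _ = s); last by apply/funext => k /=; rewrite mmapX mmap1U.
by move/F0 => ->; rewrite mulr0.
Qed.

(** * The embedding, for abstract rings in place of S_G, R_Pi, S~_G and Q_G *)

Section Unprojection.
Variables (A P : comNzRingType) (B : idomainType) (Q : fieldType).
Variables (j : {rmorphism A -> Q}) (h : {rmorphism A -> B}) (w : B).
Variables (i : {rmorphism A -> P}) (x : 'I_16 -> A) (r : 'I_3 -> P).
Hypothesis Fr0 : forall g, g \in Fforms (i \o x) r -> g = 0.
Hypothesis P_universal : forall s : 'I_3 -> Q,
  (forall g, g \in Fforms (j \o x) s -> g = 0) ->
  exists phi : {rmorphism P -> Q},
    (forall a, phi (i a) = j a) /\ (forall k, phi (r k) = s k).
Hypothesis P_generated : forall T : P -> Prop, (forall a, T (i a)) ->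
  (forall y z, T y -> T z -> T (y + z)) -> (forall k y, T y -> T (r k * y)) ->
  forall y, T y.
Hypothesis j_kernel : forall a, j a = 0 -> exists k, a = k * Gform x.
Hypothesis jG : j (Gform x) = 0.
Hypothesis jD123 : j (Dminor x 1 2 3) != 0.
Hypothesis jD246 : j (Dminor x 2 4 6) != 0.
Hypothesis regular_num135 :
  regular [:: Gform x; Dminor x 2 4 6] (num135 x).
Variable xB : 'I_16 -> B.
Hypothesis hx : h \o x = xB.
Hypothesis xB_u : xB (o 4) = w * xB (o 0) + w ^+ 2 * xB (o 1).
Hypothesis xB_v : xB (o 5) = w * xB (o 2) + w ^+ 2 * xB (o 3).
Hypothesis xB_t2 : xB (o 7) = w ^+ 3 + xB (o 6) * w.
Hypothesis xB_Delta : Delta xB != 0.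
Hypothesis xB_num123 : num123 xB != 0.
Hypothesis regular_xB : regular [:: num123 xB] (num135 xB).
Hypothesis h_kernel : forall f : {poly A},
  (map_poly h f).[w] = 0 -> in_ideal (cubic_relations x) f.
Hypothesis h_surj : forall b, exists f, (map_poly h f).[w] = b.

Let hxi k : h (x k) = xB k.
Proof. by rewrite -hx. Qed.

Let hu : h (x (o 4)) = w * h (x (o 0)) + w ^+ 2 * h (x (o 1)).
Proof. by rewrite !hxi. Qed.

Let hv : h (x (o 5)) = w * h (x (o 2)) + w ^+ 2 * h (x (o 3)).
Proof. by rewrite !hxi. Qed.

Let ht2 : h (x (o 7)) = w ^+ 3 + h (x (o 6)) * w.
Proof. by rewrite !hxi. Qed.

Let hDelta : h (Delta x) != 0.
Proof. by rewrite (rmorph_Delta h) hx. Qed.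

Let hnum123 : h (num123 x) != 0.
Proof. by rewrite (rmorph_num123 h) hx. Qed.

Let regular_h : regular [:: h (num123 x)] (h (num135 x)).
Proof. by rewrite (rmorph_num123 h) (rmorph_num135 h) hx. Qed.

Let hD : [/\ h (Dminor x 1 2 3) = 0, h (Dminor x 1 3 5) = 0 & h (Dminor x 2 4 6) = 0].
Proof.
rewrite !(rmorph_Dminor h) !DminorE // /Mentry /= hu hv ht2.
by split; ring.
Qed.

Let jh a : j a = 0 -> h a = 0.
Proof.
move/j_kernel => [k ->]; rewrite rmorphM (rmorph_Gform h).
by rewrite (@Gform_ID _ _ w) ?mulr0.
Qed.

Let ij a : j a = 0 -> i a = 0.
Proof.
by move/j_kernel => [k ->]; rewrite rmorphM (rmorph_Gform i) (Fforms_Gform Fr0) mulr0.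
Qed.

(** The third clause puts J_D^-1 in the image. The fourth, an induction principle, puts the image in
    every subring containing R_G and J_D^-1. *)
Lemma unprojection_embedding : exists phi : {rmorphism P -> Q},
  [/\ injective phi, forall a, phi (i a) = j a,
      forall q, (forall g, h g = 0 -> img j (q * j g)) -> exists y, phi y = q
    & forall T : Q -> Prop, (forall a, T (j a)) ->
        (forall q, (forall g, h g = 0 -> img j (q * j g)) -> T q) ->
        (forall q q', T q -> T q' -> T (q + q')) ->
        (forall q q', T q -> T q' -> T (q * q')) -> forall y, T (phi y)].
Proof.
have jDelta : Delta (j \o x) != 0.
  by rewrite -(rmorph_Delta j); apply: contra_neq hDelta => /jh.
have [||s sF] := @Fforms_solvable Q (j \o x) _ jDelta.
- by rewrite -(rmorph_Gform j).
- by rewrite -(rmorph_Dminor j).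
have [phi [phi_i phi_r]] := P_universal sF.
have [hD123 hD135 hD246] := hD.
have F_s k : nth 0 (Fforms (j \o x) s) k = 0.
  have [k9|k9] := ltnP k 9; last by rewrite nth_default.
  by apply/sF/mem_nth.
have s1_D123 : j (Dminor x 1 2 3) * s (o3 0) = j (num123 x).
  rewrite (rmorph_Dminor j) (rmorph_num123 j).
  exact: Dminor123_s1 (F_s 0%N) (F_s 1%N) (F_s 2%N).
have s1_D135 : j (Dminor x 1 3 5) * s (o3 0) = j (num135 x).
  rewrite (rmorph_Dminor j) (rmorph_num135 j).
  exact: Dminor135_s1 (F_s 0%N) (F_s 2%N) (F_s 4%N).
exists phi; split=> // [y z yz|q qJ|T Tj TJ TD TM y].
- suff phi0 t : phi t = 0 -> t = 0 by apply/subr0_eq/phi0; rewrite rmorphB yz subrr.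
  have [n tn] : exists n, pole_le i x r n t.
    elim/P_generated: t => [a|t1 t2 [m t1m] [n t2n]|k t [n tn]].
    + by exists 0%N, a.
    + exists (m + n)%N; apply: pole_leD; first exact: pole_le_leq.
      by rewrite addnC; exact: pole_le_leq.
    + by exists n.+1; exact: pole_le_s.
  apply: (pole_le_injective jh sF hu hv ht2 hDelta h_kernel phi_i phi_r Fr0 ij
    hD123 hnum123 _ tn).
  by rewrite s1_D123; exact: residueC.
- have [|f [a ->]] := inverse_ideal jh sF hu hv ht2 hDelta h_kernel hD s1_D123 s1_D135
      hnum123 regular_h jD246 _ h_surj qJ.
    (* Equality in Q means equality modulo G in A, so cancelling [num135] modulo D_246 is
       [regular_G]. *)
    move=> a b ab [c bE]; move: ab; rewrite {}bE -!rmorphM => /eqP.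
    rewrite -subr_eq0 -rmorphB => /eqP/j_kernel[k kE].
    have [|k1 [k2 /subr0_eq aE]] := regular_num135 (f := a).
      by exists k, c; rewrite /= -kE; ring.
    by exists k2; rewrite -rmorphM -aE rmorphB rmorphM jG mulr0 subr0.
  exists (lin_ext i x r f + i a).
  by rewrite rmorphD phi_i (phi_lin_ext _ phi_i phi_r).
- elim/P_generated: y => [a|y z Ty Tz|k y Ty]; first by rewrite phi_i.
    by rewrite rmorphD; exact: TD.
  rewrite rmorphM phi_r; apply: TM => //; apply: TJ => g hg; rewrite mulrC.
  suff -> : s k = cubic_seq j x s k by exact: (img_cubic_seq sF h_kernel).
  by case: k => [[|[|[|//]]] lti]; rewrite (bool_irrelevance lti isT).
Qed.

End Unprojection.

(** * The concrete rings and the conclusion *)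

Section Main.
Variable R : realType.
Local Notation S := (SG R).
Local Notation St := (SGt R).
Local Notation X := (fun i : 'I_16 => 'X_i : S).
Local Notation Z := (normal_point (fun k : 'I_14 => 'X_k : St)).
Local Notation D := (Dminor X).
Local Notation h := (h_map R).
Local Notation w := (xt R 5).

Definition toQ : {rmorphism S -> QG R} := fracG R \o piG R.

Lemma h_normal_point : h \o X = Z.
Proof.
apply/funext => i; rewrite [LHS]h_mapX (tnth_nth 0).
by case: i => [[|[|[|[|[|[|[|[|[|[|[|[|[|[|[|[|//]]]]]]]]]]]]]]]] lti];
  rewrite /normal_point /=
   ?(@xtE R 0 isT) ?(@xtE R 1 isT) ?(@xtE R 2 isT) ?(@xtE R 3 isT)
   ?(@xtE R 4 isT) ?(@xtE R 5 isT) ?(@xtE R 6 isT) ?(@xtE R 7 isT)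
   ?(@xtE R 8 isT) ?(@xtE R 9 isT) ?(@xtE R 10 isT) ?(@xtE R 11 isT)
   ?(@xtE R 12 isT) ?(@xtE R 13 isT).
Qed.

Lemma toQE a : toQ a = tofrac (piG R a). Proof. by []. Qed.

Lemma toQ_kernel a : toQ a = 0 <-> exists k, a = k * Gpoly R.
Proof.
split=> [/eqP|[k ->]].
  rewrite toQE tofrac_eq0 -(rmorph0 (piG R)).
  by rewrite -(Quotient.idealrBE (@Gideal R)) subr0 => /mem_ideal_gen1.
apply/eqP; rewrite toQE tofrac_eq0 -(rmorph0 (piG R)).
rewrite -(Quotient.idealrBE (@Gideal R)) subr0; apply/mem_ideal_gen1.
by exists k.
Qed.

(* G vanishes where all the L's do, but the minors need not. *)
Lemma toQ_neq0 (e : 'I_16 -> complex R) f :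
  (forall i : 'I_16, (8 <= i)%N -> e i = 0) -> meval e f != 0 -> toQ f != 0.
Proof.
move=> e0; apply: contra_neq => /toQ_kernel[k ->].
have G0 : meval e (Gpoly R) = 0.
  rewrite [LHS](rmorph_Gform (meval e)).
  rewrite (_ : _ \o _ = e); last by apply/funext => i; rewrite /= mevalXU.
  exact: Gform_eq0.
by apply: etrans (rmorphM (meval e) _ _) _; apply/eqP; rewrite mulf_eq0 orbC; apply/orP; left; apply/eqP.
Qed.

Lemma toQ_D123_neq0 : toQ (D 1 2 3) != 0.
Proof.
(* At p_4 = u = 1 and all else 0 the first three columns of M have determinant 1. *)
apply: (@toQ_neq0 (fun i => ((i == o 3) || (i == o 4))%:R)) => [i i8|].
  by rewrite -!val_eqE /= !gtn_eqF // (leq_trans _ i8).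
rewrite (rmorph_Dminor (meval _)) DminorE // /Mentry /= !mevalXU /=.
by rewrite (_ : _ - _ + _ = 1) ?oner_neq0 //; ring.
Qed.

Lemma toQ_D246_neq0 : toQ (D 2 4 6) != 0.
Proof.
apply: (@toQ_neq0 (fun i => (i == o 5)%:R)) => [i i8|].
  by rewrite -!val_eqE /= !gtn_eqF // (leq_trans _ i8).
rewrite (rmorph_Dminor (meval _)) Dminor246 /= !mevalXU /=.
by rewrite (_ : _ - _ = 1) ?oner_neq0 //; ring.
Qed.

Definition toPi : {rmorphism S -> RPi R} := piPi R \o @mpolyC 3 S.

Lemma PiGens_eq0 g : g \in Fforms (toPi \o X) (fun k => piPi R 'X_k) -> g = 0.
Proof.
have -> : Fforms (toPi \o X) (fun k => piPi R 'X_k) = map (piPi R) (PiGens R).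
  by rewrite rmorph_Fforms.
case/mapP => f fG ->; apply/eqP; rewrite -(rmorph0 (piPi R)).
rewrite -(Quotient.idealrBE (@Piideal R)) subr0; apply/asboolP.
have [k kf <-] := nthP 0 fG; exists (fun i => (i == k :> nat)%:R).
rewrite (bigD1 (Ordinal kf)) //= eqxx mul1r big1 ?addr0 // => i.
by rewrite -val_eqE /= => /negPf ->; rewrite mul0r.
Qed.

Lemma img_JDinv (q : QG R) :
  JDinv R q <-> forall g, h g = 0 -> img toQ (q * toQ g).
Proof.
split=> [qJ g hg | qI y [g hg <-]].
  have [a _ aE] := qJ (piG R g) (ex_intro2 _ _ g hg erefl).
  exists (repr a); rewrite toQE; apply: etrans (esym aE) _.
  by congr tofrac; rewrite /= reprK.
have [a aE] := qI g hg; exists (piG R a) => //; exact: esym aE.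
Qed.

Lemma RPi_generated (T : RPi R -> Prop) :
  (forall a, T (toPi a)) -> (forall y z, T y -> T z -> T (y + z)) ->
  (forall k y, T y -> T (piPi R 'X_k * y)) -> forall y, T y.
Proof.
move=> TC TD TX y; have -> : y = piPi R (repr y) by rewrite /= reprK.
exact: mpoly_generated.
Qed.

Lemma RPi_universal (s : 'I_3 -> QG R) :
  (forall g, g \in Fforms (toQ \o X) s -> g = 0) ->
  exists phi : {rmorphism RPi R -> QG R},
    (forall a, phi (toPi a) = toQ a) /\ (forall k, phi (piPi R 'X_k) = s k).
Proof.
move=> sF.
pose Phi : {rmorphism SPi R -> QG R} := mmap toQ s.
have Phi0 g : g \in @Piideal R -> Phi g = 0 by exact: mmap_Fforms.
have [phi0 phi0E] := ideal_quot_lift Phi0.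
pose phi : {rmorphism RPi R -> QG R} := phi0.
have phiE a : phi (piPi R a) = Phi a by exact: phi0E.
exists phi; split=> [a|k]; rewrite [LHS]phiE /=; first by rewrite mmapC.
by rewrite mmapX mmap1U.
Qed.

Lemma Zu : Z (o 4) = w * Z (o 0) + w ^+ 2 * Z (o 1).
Proof. by rewrite (@xtE R 5 isT). Qed.

Lemma Zv : Z (o 5) = w * Z (o 2) + w ^+ 2 * Z (o 3).
Proof. by rewrite (@xtE R 5 isT). Qed.

Lemma Zt2 : Z (o 7) = w ^+ 3 + Z (o 6) * w.
Proof. by rewrite (@xtE R 5 isT). Qed.

Lemma toQ_Gpoly : toQ (Gform X) = 0.
Proof. by apply/toQ_kernel; exists 1; rewrite mul1r. Qed.

Lemma h_ext_surj b : exists f : {poly S}, (map_poly h f).[w] = b.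
Proof. by exists (h_lift R b); exact: h_liftK. Qed.

Lemma toQ_kernelW a : toQ a = 0 -> exists k, a = k * Gform X.
Proof. by move/toQ_kernel. Qed.

Lemma RPi_embedding : exists phi : {rmorphism RPi R -> QG R},
  [/\ injective phi, forall a, phi (toPi a) = toQ a,
      forall q, (forall g, h g = 0 -> img toQ (q * toQ g)) -> exists y, phi y = q
    & forall T : QG R -> Prop, (forall a, T (toQ a)) ->
        (forall q, (forall g, h g = 0 -> img toQ (q * toQ g)) -> T q) ->
        (forall q q', T q -> T q' -> T (q + q')) ->
        (forall q q', T q -> T q' -> T (q * q')) -> forall y, T (phi y)].
Proof.
have := @unprojection_embedding S (RPi R) St (QG R) toQ h w toPi X
  (fun k => piPi R 'X_k).
move=> /(_ PiGens_eq0).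
move=> /(_ RPi_universal).
move=> /(_ RPi_generated).
move=> /(_ toQ_kernelW).
move=> /(_ toQ_Gpoly).
move=> /(_ toQ_D123_neq0).
move=> /(_ toQ_D246_neq0).
move=> /(_ (@regular_G (complex R))).
move=> /(_ Z h_normal_point).
move=> /(_ Zu).
move=> /(_ Zv).
move=> /(_ Zt2).
move=> /(_ (Delta_neq0 (complex R))).
move=> /(_ (num123_neq0 (complex R))).
move=> /(_ (@regular_residues (complex R))).
move=> /(_ (@h_ext_kernel R)).
move=> /(_ h_ext_surj).
exact.
Qed.

End Main.

Local Open Scope classical_set_scope.

Theorem proposition3p1 (R : realType) :
  (exists phi : {rmorphism RPi R -> QG R},
     [/\ injective phi,
         range phi = unprojection_ring R
       & forall f : SG R, phi (piPi R f%:MP) = fracG R (piG R f)])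
  /\ GRing.integral_domain_axiom (RPi R).
Proof.
have [phi [phi_inj phi_toPi phi_inv phi_ind]] := RPi_embedding R.
split; last first.
  move=> y z /(congr1 phi)/eqP; rewrite rmorphM rmorph0 mulf_eq0.
  by case/orP=> /eqP y0; apply/orP; [left|right]; apply/eqP/phi_inj; rewrite rmorph0.
exists phi; split=> //; apply/seteqP; split=> [_ [y _ <-] M [[M1 MB MM] GM]|].
  have {}MB a b : M a -> M b -> M (a - b).
    by move=> Ma Mb; have := MB a b; rewrite !inE; apply.
  have M0 : M 0 by move: M1; rewrite inE => M1; rewrite -(subrr 1); exact: MB.
  apply: phi_ind => [a|q /img_JDinv qJ|a b Ma Mb|a b Ma Mb].
  - by apply: GM; left; exists (piG R a).
  - by apply: GM; right.
  (* Subrings are given as closed under subtraction, so a + b is written a - (0 - b). *)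
  - by rewrite -[b]opprK -[- b]sub0r; apply: (MB) => //; exact: MB.
  - by have := MM a b; rewrite !inE; apply.
(* The image is itself a subring containing R_G and J_D^-1. *)
apply: smallest_sub => [|q [[a _ <-]|/img_JDinv/phi_inv[y <-]]]; last by exists y.
- split; rewrite ?inE; first by exists 1; rewrite // rmorph1.
    by move=> a b; rewrite !inE => -[y _ <-] [z _ <-]; exists (y - z); rewrite // rmorphB.
  by move=> a b; rewrite !inE => -[y _ <-] [z _ <-]; exists (y * z); rewrite // rmorphM.
- exists (toPi R (repr a)) => //; rewrite phi_toPi toQE.
  by congr tofrac; rewrite /= reprK.
Qed.
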